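(* Let $N\ge 2$ be an integer and consider the hydrodynamic-type system in the independent variables $(x,y)$ for the $N$ unknown real functions $a>0$ and $b_1,\dots,b_{N-1}$: $$a_y=2a^{1/2}\Bigl(\sum_{m=1}^{N-1}b_m\Bigr)_x+a^{-1/2}a_x\sum_{m=1}^{N-1}b_m,$$ $$(b_k)_y=a^{-1/2}b_k(b_k)_x-\bigl[1+(b_k)^2\bigr](a^{-1/2})_x,\qquad k=1,\dots,N-1.$$ This system is semi-Hamiltonian and has the following properties. (i) It is diagonalizable: on any domain of the variables $(a,\mathbf{b})$, $\mathbf{b}=(b_1,\dots,b_{N-1})$, where the $b_m$ are pairwise distinct and the equation $$N\frac{q}{1+q^2}=\sum_{m=1}^{N-1}\frac{1}{q-b_m}$$ has $N$ distinct roots $q_1(\mathbf{b}),\dots,q_N(\mathbf{b})$, the functions $$r^k=a^{-1/2}(1+q_k^2)^{-N/2}\prod_{m=1}^{N-1}(q_k-b_m),\qquad k=1,\dots,N,$$ are Riemann invariants (local coordinates in the space of variables $(a,\mathbf{b})$), in terms of which the system takes the form $$r^k_y=\mu_k\,r^k_x,\qquad \mu_k=a^{-1/2}q_k(\mathbf{b}),\qquad k=1,\dots,N.$$ (ii) It has infinitely many conservation laws $(\rho)_y=(\sigma)_x$, whose densities $\rho$ and fluxes $\sigma$ are polynomial and depend only on $a$ (through $a^{1/2}$) and on the moments $$B^k=\frac{1}{k+1}\sum_{m=1}^{N-1}(b_m)^{k+1},\qquad k=0,1,2,\dots.$$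
   Context: Subscripts $x,y$ denote partial derivatives. A hydrodynamic-type system is a first-order quasilinear system $u^i_y=\sum_j v^i_j(u)u^j_x$. It is diagonalizable if there are local coordinates $r^1,\dots,r^N$ (Riemann invariants) in the space of dependent variables in which it reads $r^i_y=\mu_i(\mathbf{r})r^i_x$ (no summation); $\mu_i$ are the characteristic velocities. A conservation law is a pair of functions $\rho(u),\sigma(u)$ with $(\rho)_y=(\sigma)_x$ on all solutions; ''infinitely many'' means infinitely many linearly independent ones with non-constant densities. A diagonal system with pairwise distinct characteristic velocities $\mu_i(\mathbf{r})$ is semi-Hamiltonian if, for all pairwise distinct $i,j,k$, $$\frac{\partial}{\partial r^k}\left(\frac{\partial\mu_i/\partial r^j}{\mu_j-\mu_i}\right)=\frac{\partial}{\partial r^j}\left(\frac{\partial\mu_i/\partial r^k}{\mu_k-\mu_i}\right),$$ and a diagonalizable system is called semi-Hamiltonian if its diagonal form is. All objects are smooth and statements are local, on domains where the roots $q_k$ are distinct. *)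

(* Defs.v *)
(* MathComp-Analysis, over an arbitrary R : realType. *)
From HB Require Import structures.
From mathcomp Require Import all_boot all_order all_algebra.
From mathcomp Require Import all_classical all_reals all_analysis.
From mathcomp Require mpoly.

Set Implicit Arguments.
Unset Strict Implicit.
Unset Printing Implicit Defensive.

Import Order.TTheory GRing.Theory Num.Theory.
Import numFieldNormedType.Exports.

Local Open Scope classical_set_scope.
Local Open Scope ring_scope.

Section Calculus.
Variable R : realType.

Definition partial (n : nat) (i : 'I_n) (f : 'rV[R]_n -> R) (x : 'rV[R]_n) : R :=
  'D_(delta_mx 0 i) f x.

(* Class C^k on U, meant for U open. *)
Fixpoint class_C (k n : nat) (U : set 'rV[R]_n) (f : 'rV[R]_n -> R) : Prop :=
  match k with
  | 0 => forall x, U x -> {for x, continuous f}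
  | k'.+1 => (forall x, U x -> differentiable f x) /\
             (forall i : 'I_n, class_C k' U (partial i f))
  end.

Definition smooth (n : nat) (U : set 'rV[R]_n) (f : 'rV[R]_n -> R) : Prop :=
  forall k, class_C k U f.

Definition smooth_map (n p : nat) (U : set 'rV[R]_n)
    (F : 'rV[R]_n -> 'rV[R]_p) : Prop :=
  forall i : 'I_p, smooth U (fun x => F x 0 i).

(* r is a smooth coordinate system on U, with image V and inverse Phi. *)
Definition coordinates (n : nat) (U V : set 'rV[R]_n)
    (r Phi : 'rV[R]_n -> 'rV[R]_n) : Prop :=
  [/\ open U /\ open V,
      smooth_map U r /\ smooth_map V Phi,
      (forall u, U u -> V (r u)) /\ (forall s, V s -> U (Phi s)),
      (forall u, U u -> Phi (r u) = u) & (forall s, V s -> r (Phi s) = s)].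

End Calculus.

Section HydrodynamicSystems.
Variable R : realType.

(* The plane of independent variables is 'rV[R]_2, with x = coordinate 0 and
   y = coordinate 1. *)
Definition d_x (f : 'rV[R]_2 -> R) (z : 'rV[R]_2) : R := partial 0 f z.
Definition d_y (f : 'rV[R]_2 -> R) (z : 'rV[R]_2) : R := partial 1 f z.

(* A first-order system for p unknown functions w of (x, y): S w z says that the
   equations hold for w at the point z. *)
Definition pde (p : nat) : Type := ('rV[R]_2 -> 'rV[R]_p) -> 'rV[R]_2 -> Prop.

(* In the coordinates r on U the system S reads r^i_y = M_i(r) r^i_x.  Being a
   rewriting of the equations, this is required at each point for all smooth
   fields with values in U, not only for those that solve S. *)
Definition diagonal_form (p : nat) (S : pde p) (U V : set 'rV[R]_p)
    (r Phi : 'rV[R]_p -> 'rV[R]_p) (M : 'I_p -> 'rV[R]_p -> R) : Prop :=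
  [/\ coordinates U V r Phi,
      forall i, smooth V (M i) &
      forall (Omega : set 'rV[R]_2) (w : 'rV[R]_2 -> 'rV[R]_p),
        open Omega -> smooth_map Omega w -> (forall z, Omega z -> U (w z)) ->
        forall z, Omega z ->
          S w z <->
          (forall i, d_y (fun z' => r (w z') 0 i) z =
                     M i (r (w z)) * d_x (fun z' => r (w z') 0 i) z)].

Definition diagonalizable_system (p : nat) (S : pde p) (D : set 'rV[R]_p) : Prop :=
  forall u, D u -> exists U V r Phi M,
    [/\ U u, U `<=` D & diagonal_form S U V r Phi M].

(* r^1, ..., r^p are Riemann invariants of S on D, with characteristic velocities
   mu_i given as functions of the original variables. *)
Definition riemann_invariants (p : nat) (S : pde p) (D : set 'rV[R]_p)
    (r : 'I_p -> 'rV[R]_p -> R) (mu : 'I_p -> 'rV[R]_p -> R) : Prop :=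
  forall u, D u -> exists U V Phi,
    [/\ U u, U `<=` D &
        diagonal_form S U V (fun u' => \row_i r i u') Phi
                      (fun i s => mu i (Phi s))].

Definition semi_hamiltonian_velocities (p : nat) (V : set 'rV[R]_p)
    (M : 'I_p -> 'rV[R]_p -> R) : Prop :=
  (forall s, V s -> injective (fun i => M i s)) /\
  (forall i j k : 'I_p, i != j -> j != k -> i != k ->
     forall s, V s ->
       partial k (fun t => partial j (M i) t / (M j t - M i t)) s =
       partial j (fun t => partial k (M i) t / (M k t - M i t)) s).

(* When the velocities are pairwise distinct, the diagonal form is unique up to
   permutations and changes r^i -> f_i(r^i), which preserve the condition; hence
   the choice of the diagonal form is immaterial. *)
Definition semi_hamiltonian (p : nat) (S : pde p) (D : set 'rV[R]_p) : Prop :=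
  forall u, D u -> exists U V r Phi M,
    [/\ U u, U `<=` D, diagonal_form S U V r Phi M &
        semi_hamiltonian_velocities V M].

Definition conservation_law (p : nat) (S : pde p) (D : set 'rV[R]_p)
    (rho sigma : 'rV[R]_p -> R) : Prop :=
  [/\ smooth D rho, smooth D sigma &
      forall (Omega : set 'rV[R]_2) (w : 'rV[R]_2 -> 'rV[R]_p),
        open Omega -> smooth_map Omega w -> (forall z, Omega z -> D (w z)) ->
        (forall z, Omega z -> S w z) ->
        forall z, Omega z ->
          d_y (fun z' => rho (w z')) z = d_x (fun z' => sigma (w z')) z].

Definition nonconstant_on (p : nat) (U : set 'rV[R]_p) (f : 'rV[R]_p -> R) : Prop :=
  ~ exists c, forall u, U u -> f u = c.

Definition linearly_independent_on (p : nat) (U : set 'rV[R]_p)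
    (f : nat -> 'rV[R]_p -> R) : Prop :=
  forall (m : nat) (c : 'I_m -> R),
    (forall u, U u -> \sum_(j < m) c j * f j u = 0) -> forall j, c j = 0.

End HydrodynamicSystems.

Section TheSystem.
Variables (R : realType) (n : nat).

(* Here N = n.+1.  A point (a, b_1, ..., b_(N-1)) is a row vector whose entry 0
   is a and whose remaining n entries are the b_m. *)
Definition acoord (u : 'rV[R]_n.+1) : R := u 0 ord0.
Definition bcoord (u : 'rV[R]_n.+1) : 'rV[R]_n := \row_m u 0 (lift ord0 m).

Definition ab_system : pde R n.+1 := fun w z =>
  let a z' := acoord (w z') in
  let b m z' := bcoord (w z') 0 m in
  d_y a z = 2 * Num.sqrt (a z) * d_x (fun z' => \sum_(m < n) b m z') z
            + (Num.sqrt (a z))^-1 * d_x a z * \sum_(m < n) b m z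
  /\ forall k : 'I_n,
     d_y (b k) z = (Num.sqrt (a z))^-1 * b k z * d_x (b k) z
                   - (1 + b k z ^+ 2) * d_x (fun z' => (Num.sqrt (a z'))^-1) z.

(* The explicit q != b_m excludes the points where the convention 1 / 0 = 0
   would make the equation meaningful. *)
Definition critical_root (b : 'rV[R]_n) (q : R) : Prop :=
  (forall m, q != b 0 m) /\
  n.+1%:R * (q / (1 + q ^+ 2)) = \sum_(m < n) (q - b 0 m)^-1.

Definition phase_space : set 'rV[R]_n.+1 := [set u | 0 < acoord u].

Definition regular_domain : set 'rV[R]_n.+1 :=
  [set u | [/\ 0 < acoord u,
               injective (fun m => bcoord u 0 m) &
               exists q : 'I_n.+1 -> R,
                 injective q /\ forall k, critical_root (bcoord u) (q k)]].

(* q_1, ..., q_N list the distinct roots over D by continuous branches; a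
   labelling that jumps from root to root would not give smooth r^k. *)
Definition root_branches (D : set 'rV[R]_n.+1) (q : 'I_n.+1 -> 'rV[R]_n -> R) : Prop :=
  forall u, D u ->
    [/\ injective (fun k => q k (bcoord u)),
        forall k, critical_root (bcoord u) (q k (bcoord u)) &
        forall k, {for bcoord u, continuous (q k)}].

Definition riemann_r (q : 'I_n.+1 -> 'rV[R]_n -> R) (k : 'I_n.+1)
    (u : 'rV[R]_n.+1) : R :=
  (Num.sqrt (acoord u))^-1
  * (1 + q k (bcoord u) ^+ 2) `^ (- (n.+1%:R / 2))
  * \prod_(m < n) (q k (bcoord u) - bcoord u 0 m).

Definition velocity (q : 'I_n.+1 -> 'rV[R]_n -> R) (k : 'I_n.+1)
    (u : 'rV[R]_n.+1) : R :=
  (Num.sqrt (acoord u))^-1 * q k (bcoord u).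

Definition moment (k : nat) (u : 'rV[R]_n.+1) : R :=
  k.+1%:R^-1 * \sum_(m < n) bcoord u 0 m ^+ k.+1.

(* f = P(a^(1/2), B^0, ..., B^(K-1)) for some K and some polynomial P over R. *)
Definition polynomial_in_moments (f : 'rV[R]_n.+1 -> R) : Prop :=
  exists (K : nat) (P : mpoly.mpoly K.+1 R),
    forall u, phase_space u ->
      f u = mpoly.meval (fun i : 'I_K.+1 =>
              if unlift ord0 i is Some k then moment k u
              else Num.sqrt (acoord u)) P.

End TheSystem.

(* Main.v *)
Require Import Defs.
From HB Require Import structures.
From mathcomp Require Import all_boot all_order all_algebra.
From mathcomp Require Import all_classical all_reals all_analysis.
From mathcomp Require mpoly.
From mathcomp Require Import ring lra zify.

Set Implicit Arguments.
Unset Strict Implicit.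
Unset Printing Implicit Defensive.

Import Order.TTheory GRing.Theory Num.Theory.
Import numFieldNormedType.Exports.
Import (canonicals) mpoly.

Local Open Scope classical_set_scope.
Local Open Scope ring_scope.

(** Write N = n + 1, s = a^(1/2) and
<<
      F(q) = s^-1 (1 + q^2)^(-N/2) \prod_m (q - b_m).
>>
    The critical equation says that F_q = 0, so the r^k are the critical values of
    F.  For every q off the b_m, the system implies
<<
      F_y - (q/s) F_x = - (1 + q^2) (s_x / s^2) F_q ,
>>
    and at a critical point q_k this reads r^k_y = (q_k/s) r^k_x, because a critical
    value does not see the motion of the critical point
    ([is_derive_critical_value]).  The converse, the independence of the r^k and
    the simplicity of the roots all rest on one fact of linear algebra: if
    c_0 + \sum_m c_m / (q_k - b_m) = 0 for N distinct values q_k, then c = 0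
    ([cauchy_system], used in [diagonal_algebra], [jac_riemann_r] and
    [dcrit_neq0]).  Local coordinates come from a smooth inverse function theorem
    ([inverse_function]); it is applied once to (q, b) |-> (critical equation, b),
    to obtain smooth branches of roots ([root_branches_smooth]), and once to the
    map r ([riemann_coordinates]).

    For the semi-Hamiltonian property, put A_j = d log s / dr^j.  Along r^j all the
    other r^i are constant, which gives
<<
      d b_m / dr^j = A_j (1 + b_m^2) / (q_j - b_m) ,
      d q_i / dr^j = A_j (1 + q_i^2) / (q_j - q_i)           (i <> j) ,
>>
    and the symmetry of the second derivatives of b_m ([partialC]) then forces
<<
      d A_j / dr^k = 2 (1 + q_j q_k) / (q_j - q_k)^2 A_j A_k   (j <> k).
>>
    With these three rules the semi-Hamiltonian condition is an identity between
    rational functions ([sh_algebra]).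

    The conservation laws are residues at q = oo: the equation for F shows that
    the residues of (1 + q^2)^(-3/2) F^(-j) dq and s^-1 q (1 + q^2)^(-3/2) F^(-j) dq
    are a density and its flux.  In the variable w = 1/q they become
<<
      s^j [w^(j-2)] W_j       and      s^(j-1) [w^(j-1)] W_j ,
      W_j = (1 + w^2)^((j N - 3)/2) \prod_m (1 - b_m w)^(-j) .
>>
    The logarithmic derivative of W_j has coefficients which are affine in the power
    sums of the b_m, so the coefficients of W_j are given by a recursion
    ([expc]) which makes them polynomials in the moments, and the conservation law
    becomes an identity between these coefficients ([lax_coef_identity]).  The
    densities are homogeneous in s of distinct positive degrees with coefficients
    that vanish on no open set, whence their independence modulo constants. *)

(** * Differentiable and smooth functions of several variables *)

Section RowTopology.
Variable R : realType.

Lemma open_near n (A : set 'rV[R]_n) :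
  (forall x, A x -> \forall y \near x, A y) -> open A.
Proof. by rewrite openE => H x /H. Qed.

Lemma near_forall n (I : finType) (P : I -> 'rV[R]_n -> Prop) (x : 'rV[R]_n) :
  (forall i, \forall y \near x, P i y) -> \forall y \near x, forall i, P i y.
Proof. exact: (@filter_forall 'rV[R]_n I P (nbhs x) _). Qed.

Lemma near_open p (P : 'rV[R]_p -> Prop) (x : 'rV[R]_p) :
  (\forall y \near x, P y) -> exists W : set 'rV[R]_p, [/\ open W, W x & W `<=` P].
Proof. by rewrite /prop_near1 nbhsE => -[W [oW Wx] WP]; exists W. Qed.

Lemma continuous_near_neq0 (T : topologicalType) (f : T -> R) x :
  {for x, continuous f} -> f x != 0 -> \forall y \near x, f y != 0.
Proof.
move=> fc f0; exact: (@cvgr_neq0 R R T (nbhs x) _ f (f x) fc f0).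
Qed.

Lemma continuous_rV (T : topologicalType) p (F : T -> 'rV[R]_p) (x : T) :
  (forall i, {for x, continuous (fun y => F y 0 i)}) -> {for x, continuous F}.
Proof.
move=> Fc A /= /nbhs_ballP[e e0 eA].
have := @filter_forall _ 'I_p (fun i y => ball (F x 0 i) e (F y 0 i)) (nbhs x) _.
have Fb i : \forall y \near x, ball (F x 0 i) e (F y 0 i).
  by apply: (Fc i); exact: nbhsx_ballx.
move=> /(_ _ Fb); apply: filterS => y Fy; apply: eA; split => // j i.
by rewrite (ord1 j); exact: Fy.
Qed.

End RowTopology.

Section DifferentiableCriteria.
Variable R : realType.

(** The remainder condition hidden in the definition of the differential, spelled
    out so that a candidate differential can be checked by estimates. *)
Lemma differentiable_eps (V W : normedModType R) (f : V -> W) (x : V)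
    (L : {linear V -> W}) :
  continuous L ->
  (forall e, 0 < e ->
     \forall h \near (0 : V), `|f (h + x) - (f x + L h)| <= e * `|h|) ->
  differentiable f x /\ ('d f x = L :> (V -> W)).
Proof.
move=> Lc Lf.
have fL : f \o shift x = cst (f x) + L +o_ 0 id.
  by apply/eqaddoP => _/posnumP[e]; exact: Lf.
have dL := diff_unique Lc fL; split => //.
by apply/diff_locallyP; rewrite dL.
Qed.

Lemma differentiable_epsP (V W : normedModType R) (f : V -> W) (x : V) :
  differentiable f x -> forall e, 0 < e ->
    \forall h \near (0 : V), `|f (h + x) - (f x + 'd f x h)| <= e * `|h|.
Proof. by move=> /diff_locally /eqaddoP h e e0; have := h _ e0. Qed.

Lemma near_eq_differentiable (V W : normedModType R) (f g : V -> W) (x : V) :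
  (\near x, f x = g x) -> differentiable f x -> differentiable g x.
Proof.
move=> fg df; have fgx := nbhs_singleton fg.
have dc : continuous ('d f x) by exact: diff_continuous.
suff [] : differentiable g x /\ ('d g x = 'd f x :> (V -> W)) by [].
apply: differentiable_eps => // e e0.
have := differentiable_epsP df e0.
have : \forall h \near (0 : V), f (h + x) = g (h + x).
  by move: fg; rewrite (near_shift 0) subr0; apply: filterS => h /=.
by apply: filterS2 => h <-; rewrite fgx.
Qed.

Lemma rV_differentiable (V : normedModType R) p (F : V -> 'rV[R]_p) (x : V) :
  (forall i, differentiable (fun y => F y 0 i) x) -> differentiable F x.
Proof.
move=> dF.
have -> : F = \sum_(i < p) (fun y => F y 0 i *: (delta_mx 0 i : 'rV[R]_p)).
  apply/funext => y; rewrite [LHS]row_sum_delta fct_sumE; apply: eq_bigr => i _.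
  by [].
apply: differentiable_sum => i; exact: differentiableZl.
Qed.

End DifferentiableCriteria.

Section SmoothFunctions.
Variable R : realType.

Lemma diff_rowE (W : normedModType R) n (f : 'rV[R]_n -> W) (x v : 'rV[R]_n) :
  differentiable f x -> 'd f x v = \sum_(i < n) v 0 i *: 'D_(delta_mx 0 i) f x.
Proof.
move=> df; rewrite {1}[v]row_sum_delta linear_sum; apply: eq_bigr => i _.
by rewrite linearZ/= deriveE.
Qed.

(** Derivatives at a point of an open set only involve the values on that set: a
    formula that is valid on U alone may replace the function. *)
Lemma class_C_near n k (U : set 'rV[R]_n) (f g : 'rV[R]_n -> R) :
  open U -> (forall x, U x -> f x = g x) -> class_C k U f -> class_C k U g.
Proof.
move=> oU; elim: k f g => [|k IH] f g fg /=.
  move=> fC x Ux; have near_fg : \near x, f x = g x.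
    by apply: filterS (open_nbhs_nbhs (conj oU Ux)) => y /fg.
  rewrite /prop_for /continuous_at -(fg _ Ux); apply: (cvg_trans _ (fC x Ux)).
  exact: (near_eq_cvg near_fg).
move=> [fd fC]; have near_fg x : U x -> \near x, f x = g x.
  by move=> Ux; apply: filterS (open_nbhs_nbhs (conj oU Ux)) => y /fg.
split=> [x Ux|i]; first by apply: near_eq_differentiable (fd x Ux); exact: near_fg.
by apply: IH (fC i) => x Ux; apply: near_eq_derive; exact: near_fg.
Qed.

Lemma class_CW n k (U : set 'rV[R]_n) f : class_C k.+1 U f -> class_C k U f.
Proof.
elim: k f => [|k IH] f.
  by move=> [fd _] x Ux; exact: differentiable_continuous (fd x Ux).
by move=> [fd fC]; split=> // i; exact: IH.
Qed.

Lemma class_CS n k (U V : set 'rV[R]_n) f :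
  V `<=` U -> class_C k U f -> class_C k V f.
Proof.
move=> VU; elim: k f => [|k IH] f /=; first by move=> h x /VU; exact: h.
by move=> [fd fC]; split=> [x /VU|i]; [exact: fd|exact/IH].
Qed.

Lemma class_C_cst n k (U : set 'rV[R]_n) (c : R) : class_C k U (fun=> c).
Proof.
elim: k c => [|k IH] c /=; first by move=> x _; exact: cst_continuous.
split=> [x _|i]; first exact: differentiable_cst.
suff -> : partial i (fun=> c) = fun=> 0 by exact: IH.
by apply/funext => x; rewrite /partial derive_cst.
Qed.

Lemma class_CD n k (U : set 'rV[R]_n) (f g : 'rV[R]_n -> R) : open U ->
  class_C k U f -> class_C k U g -> class_C k U (fun x => f x + g x).
Proof.
move=> oU; elim: k f g => [|k IH] f g /=.
  by move=> fC gC x Ux; apply: continuousD; [exact: fC|exact: gC].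
move=> [fd fC] [gd gC]; split=> [x Ux|i].
  by apply: differentiableD; [exact: fd|exact: gd].
apply: class_C_near (IH _ _ (fC i) (gC i)) => // x Ux.
by apply/esym/deriveD; apply: diff_derivable; [exact: fd|exact: gd].
Qed.

(** The induction step needs the undifferentiated factors to be of class C^k as
    well, which is [class_CW]. *)
Lemma class_CM n k (U : set 'rV[R]_n) (f g : 'rV[R]_n -> R) : open U ->
  class_C k U f -> class_C k U g -> class_C k U (fun x => f x * g x).
Proof.
move=> oU; elim: k f g => [|k IH] f g.
  by move=> fC gC x Ux; apply: continuousM; [exact: fC|exact: gC].
move=> fC1 gC1; have [fd fC] := fC1; have [gd gC] := gC1; split=> [x Ux|i].
  by apply: differentiableM; [exact: fd|exact: gd].
apply: class_C_near (class_CD oU (IH _ _ (class_CW fC1) (gC i))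
  (IH _ _ (class_CW gC1) (fC i))) => // x Ux.
by apply/esym/deriveM; apply: diff_derivable; [exact: fd|exact: gd].
Qed.

Lemma class_CB n k (U : set 'rV[R]_n) (f g : 'rV[R]_n -> R) : open U ->
  class_C k U f -> class_C k U g -> class_C k U (fun x => f x - g x).
Proof.
move=> oU fC gC.
apply: class_C_near (class_CD oU fC (class_CM oU (class_C_cst k U (-1)) gC)) => // x _.
by rewrite mulN1r.
Qed.

Lemma class_C_sum n k (U : set 'rV[R]_n) (I : Type) (s : seq I) (P : pred I)
    (f : I -> 'rV[R]_n -> R) : open U ->
  (forall i, class_C k U (f i)) -> class_C k U (fun x => \sum_(i <- s | P i) f i x).
Proof.
move=> oU fC; elim: s => [|i s IH].
  apply: class_C_near (class_C_cst k U 0) => // x _; by rewrite big_nil.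
case Pi : (P i); last first.
  by apply: class_C_near IH => // x _; rewrite big_cons Pi.
by apply: class_C_near (class_CD oU (fC i) IH) => // x _; rewrite big_cons Pi.
Qed.

Lemma class_C_prod n k (U : set 'rV[R]_n) (I : Type) (s : seq I) (P : pred I)
    (f : I -> 'rV[R]_n -> R) : open U ->
  (forall i, class_C k U (f i)) -> class_C k U (fun x => \prod_(i <- s | P i) f i x).
Proof.
move=> oU fC; elim: s => [|i s IH].
  apply: class_C_near (class_C_cst k U 1) => // x _; by rewrite big_nil.
case Pi : (P i); last first.
  by apply: class_C_near IH => // x _; rewrite big_cons Pi.
by apply: class_C_near (class_CM oU (fC i) IH) => // x _; rewrite big_cons Pi.
Qed.

Lemma class_CX n k (U : set 'rV[R]_n) f m : open U ->
  class_C k U f -> class_C k U (fun x => f x ^+ m).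
Proof.
move=> oU fC; elim: m => [|m IH].
  by apply: class_C_near (class_C_cst k U 1) => // x _; rewrite expr0.
by apply: class_C_near (class_CM oU fC IH) => // x _; rewrite exprS.
Qed.

Lemma class_C_coord n k (U : set 'rV[R]_n) (i : 'I_n) :
  class_C k U (fun x => x 0 i).
Proof.
case: k => [x _|k]; first exact: coord_continuous.
split=> [x _|j]; first exact: differentiable_coord.
suff -> : partial j (fun x : 'rV[R]_n => x 0 i) = fun=> (delta_mx 0 j : 'rV[R]_n) 0 i.
  exact: class_C_cst.
apply/funext => x; rewrite /partial.
have /rowP/(_ i) := @derive_mx R _ _ _ id x (delta_mx 0 j) (@derivable_id _ _ _ _).
by rewrite derive_id => ->; rewrite [RHS]mxE.
Qed.

(** Restricting g to the line through x directed by v reduces this to the chain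
    rule for functions of one variable. *)
Lemma is_derive_comp1 (V : normedModType R) (f : R -> R) (g : V -> R)
    (x v : V) df dg :
  is_derive (g x) 1 f df -> is_derive x v g dg ->
  is_derive x v (fun y => f (g y)) (df * dg).
Proof.
move=> [fd <-] [gd <-].
have gd1 : derivable (fun h : R => g (h *: v + x)) 0 1.
  exact: (derivable1P g x v).1 gd.
have gd2 : is_derive (0 : R) (1 : R) (fun h : R => g (h *: v + x)) ('D_v g x).
  apply: DeriveDef => //; rewrite /derive; congr (lim _).
  apply: (congr1 (fun F : R -> R => F @ _)); apply/funext => h /=.
  rewrite scale0r add0r addr0.
  by rewrite [h *: 1]mulr1.
have fd2 : is_derive (g (0 *: v + x)) 1 f ('D_1 f (g x)).
  by rewrite scale0r add0r; apply: DeriveDef.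
have := @is_derive1_comp R f (fun h : R => g (h *: v + x)) 0 _ _ fd2 gd2.
move=> [cd ce]; apply: DeriveDef; first exact: (derivable1P _ x v).2 cd.
rewrite -ce /derive; congr (lim _).
apply: (congr1 (fun F : R -> R => F @ _)); apply/funext => h /=.
by rewrite scale0r add0r addr0 [h *: 1]mulr1.
Qed.

Lemma differentiable_comp1 (V : normedModType R) (f : R -> R) (g : V -> R)
    (x : V) df :
  is_derive (g x) 1 f df -> differentiable g x ->
  differentiable (fun y => f (g y)) x.
Proof.
move=> [fd _] gd; apply: (@differentiable_comp _ _ _ _ g f) => //.
exact/derivable1_diffP.
Qed.

(** The exponent has to vary in the induction, since the derivative of g^a
    involves g^(a - 1). *)
Lemma class_C_powR n k (U : set 'rV[R]_n) (g : 'rV[R]_n -> R) (a : R) : open U ->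
  (forall x, U x -> 0 < g x) -> class_C k U g -> class_C k U (fun x => g x `^ a).
Proof.
move=> oU g0; elim: k a => [|k IH] a.
  move=> gC x Ux; have := @continuous_comp _ _ _ g (fun t : R => t `^ a) x (gC x Ux); apply.
  apply: differentiable_continuous; apply/derivable1_diffP.
  by have [] := is_derive1_powR a (g0 x Ux).
move=> gC1; have [gd gC] := gC1; split=> [x Ux|i].
  by apply: (differentiable_comp1 (is_derive1_powR a (g0 x Ux))); exact: gd.
apply: class_C_near (class_CM oU (class_CM oU (class_C_cst k U a)
  (IH (a - 1) (class_CW gC1))) (gC i)) => // x Ux.
rewrite /partial; apply/esym.
have dgx : is_derive x (delta_mx 0 i : 'rV[R]_n) g ('D_(delta_mx 0 i) g x).
  by apply/derivableP/diff_derivable/gd.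
by have [_] := is_derive_comp1 (is_derive1_powR a (g0 x Ux)) dgx.
Qed.

Lemma is_derive1_inv (x : R) : x != 0 -> is_derive x 1 (fun y : R => y^-1) (- x ^- 2).
Proof.
move=> x0; have := @is_deriveV R id x 1 1 x0 (is_derive_id _ _).
by rewrite /= [_ *: 1]mulr1.
Qed.

Lemma class_CV n k (U : set 'rV[R]_n) (g : 'rV[R]_n -> R) : open U ->
  (forall x, U x -> g x != 0) -> class_C k U g -> class_C k U (fun x => (g x)^-1).
Proof.
move=> oU g0; elim: k => [|k IH].
  move=> gC x Ux; have := @continuousV _ _ g x (g0 x Ux); apply; exact: gC.
move=> gC1; have [gd gC] := gC1; split=> [x Ux|i].
  by apply: (differentiable_comp1 (is_derive1_inv (g0 x Ux))); exact: gd.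
have IH' := IH (class_CW gC1).
apply: class_C_near (class_CM oU (class_CM oU (class_C_cst k U (-1))
  (class_CX 2 oU IH')) (gC i)) => // x Ux.
rewrite /partial; apply/esym.
have dgx : is_derive x (delta_mx 0 i : 'rV[R]_n) g ('D_(delta_mx 0 i) g x).
  by apply/derivableP/diff_derivable/gd.
have [_ ->] := is_derive_comp1 (is_derive1_inv (g0 x Ux)) dgx.
by rewrite mulN1r exprVn.
Qed.

(** By the chain rule each partial derivative of the composite is a sum of products
    of functions to which the induction hypothesis applies. *)
Lemma class_C_comp n p k (U : set 'rV[R]_n) (V : set 'rV[R]_p)
    (F : 'rV[R]_n -> 'rV[R]_p) (g : 'rV[R]_p -> R) :
  open U -> (forall x, U x -> V (F x)) ->
  (forall i, class_C k U (fun x => F x 0 i)) -> class_C k V g ->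
  class_C k U (fun x => g (F x)).
Proof.
move=> oU UV; elim: k g => [|k IH] g FC gC.
  move=> x Ux; have := @continuous_comp _ _ _ F g x; apply; last exact/gC/UV.
  by apply: continuous_rV => i; exact: (FC i).
have dF x : U x -> differentiable F x.
  by move=> Ux; apply: rV_differentiable => i; have [/(_ x Ux)] := FC i.
have [gd gC'] := gC; split=> [x Ux|i].
  by have := @differentiable_comp _ _ _ _ F g x (dF x Ux); apply; exact/gd/UV.
apply: (@class_C_near _ _ _
  (fun x => \sum_(j < p) partial j g (F x) * partial i (fun y => F y 0 j) x)) => //.
  move=> x Ux; rewrite /partial deriveE; last first.
    by have := @differentiable_comp _ _ _ _ F g x (dF x Ux); apply; exact/gd/UV.
  rewrite (diff_comp (dF x Ux) (gd _ (UV _ Ux)))/= diff_rowE; last exact/gd/UV.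
  apply: eq_bigr => j _; rewrite mulrC -deriveE; last exact: dF.
  rewrite derive_mx; last by apply: diff_derivable; exact: dF.
  by rewrite mxE.
apply: class_C_sum => // j; apply: class_CM => //; last by have [_] := FC j; apply.
by apply: IH (gC' j) => j'; exact: class_CW.
Qed.

End SmoothFunctions.
Section PointwiseDerivatives.
Variables (R : realType) (V : normedModType R).
Implicit Types (f g : V -> R) (x v : V).

Lemma is_derive_add f g x v (df dg : R) :
  is_derive x v f df -> is_derive x v g dg ->
  is_derive x v (fun y => f y + g y) (df + dg).
Proof. by move=> hf hg; apply: is_deriveD. Qed.

Lemma is_derive_sub f g x v (df dg : R) :
  is_derive x v f df -> is_derive x v g dg ->
  is_derive x v (fun y => f y - g y) (df - dg).
Proof. by move=> hf hg; apply: is_deriveB. Qed.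

Lemma is_derive_mul f g x v (df dg : R) :
  is_derive x v f df -> is_derive x v g dg ->
  is_derive x v (fun y => f y * g y) (df * g x + f x * dg).
Proof.
move=> hf hg; apply: is_derive_eq (is_deriveM hf hg) _.
by rewrite addrC [g x *: df]mulrC.
Qed.

Lemma is_derive_inv f x v (df : R) : f x != 0 ->
  is_derive x v f df -> is_derive x v (fun y => (f y)^-1) (- df / f x ^+ 2).
Proof.
move=> f0 hf; apply: is_derive_eq (is_derive_comp1 (is_derive1_inv f0) hf) _.
by rewrite mulNr mulrC mulNr.
Qed.

Lemma is_derive_exp f x v (df : R) m :
  is_derive x v f df -> is_derive x v (fun y => f y ^+ m) (m%:R * f x ^+ m.-1 * df).
Proof.
move=> hf; elim: m => [|m IH].
  rewrite mul0r mul0r; apply: is_derive_eq (is_derive_cst (1 : R) x v) _.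
  by [].
have -> : (fun y => f y ^+ m.+1) = (fun y => f y * f y ^+ m).
  by apply/funext => y; rewrite exprS.
apply: is_derive_eq (is_derive_mul hf IH) _ => /=.
case: m {IH} => [|m] /=; first by rewrite expr0 !mul0r mulr0 addr0 mulr1 !mul1r.
by rewrite -[m.+2%:R]natr1 exprS; ring.
Qed.

Lemma is_derive_bigsum n (f : 'I_n -> V -> R) x v (df : 'I_n -> R) :
  (forall i, is_derive x v (f i) (df i)) ->
  is_derive x v (fun y => \sum_(i < n) f i y) (\sum_(i < n) df i).
Proof.
move=> hf; have := is_derive_sum hf; congr is_derive.
by apply/funext => y; rewrite fct_sumE.
Qed.

Lemma is_derive_unique f x v (d1 d2 : R) :
  is_derive x v f d1 -> is_derive x v f d2 -> d1 = d2.
Proof. by move=> [_ <-] [_ <-]. Qed.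

End PointwiseDerivatives.

Lemma is_derive_coord (R : realType) n (x v : 'rV[R]_n) i :
  is_derive x v (fun y : 'rV[R]_n => y 0 i) (v 0 i).
Proof.
apply: DeriveDef; first exact: diff_derivable (differentiable_coord _ _ _).
have /rowP/(_ i) := @derive_mx R _ _ _ id x v (@derivable_id _ _ _ _).
by rewrite derive_id => ->; rewrite [RHS]mxE.
Qed.

Lemma smooth_is_derive (R : realType) n (U : set 'rV[R]_n) (f : 'rV[R]_n -> R) x v :
  smooth U f -> U x -> is_derive x v f ('D_v f x).
Proof. by move=> /(_ 1%N) [fd _] Ux; apply/derivableP/diff_derivable/fd. Qed.

(** * The inverse function theorem *)

Section Norms.
Variable R : realType.

Lemma normr_coord n (v : 'rV[R]_n) i : `|v 0 i| <= `|v|.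
Proof.
rewrite [leRHS]/Num.Def.normr/= mx_normrE.
exact: (le_bigmax _ (fun ij : 'I_1 * 'I_n => `|v ij.1 ij.2|) (0, i)).
Qed.

Lemma normr_row_le n (v : 'rV[R]_n) M :
  0 <= M -> (forall i, `|v 0 i| <= M) -> `|v| <= M.
Proof.
move=> M0 vM; rewrite [leLHS]/Num.Def.normr/= mx_normrE.
by apply: bigmax_le => // -[j i] _; rewrite (ord1 j).
Qed.

Lemma normr_mulmx n m (A : 'M[R]_(n, m)) : exists2 C, 0 < C &
  forall v : 'rV[R]_n, `|v *m A| <= C * `|v|.
Proof.
have S0 i : 0 <= \sum_j `|A i j| by exact: sumr_ge0.
exists (1 + \sum_i \sum_j `|A i j|); first by rewrite ltr_pwDl// sumr_ge0.
move=> v; apply: normr_row_le; first by rewrite mulr_ge0// addr_ge0// sumr_ge0.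
move=> j; rewrite mxE (le_trans (ler_norm_sum _ _ _))//.
rewrite mulrDl mul1r ler_wpDl// mulr_suml; apply: ler_sum => i _.
rewrite normrM mulrC ler_pM//; last exact: normr_coord.
by rewrite (bigD1 j)//= lerDl sumr_ge0.
Qed.

Lemma mulmx_row_continuous n m (A : 'M[R]_(n, m)) :
  continuous (mulmxr A : 'rV[R]_n -> 'rV[R]_m).
Proof.
move=> v; apply: differentiable_continuous; apply: rV_differentiable => j.
have [dC _] : class_C 1 setT (fun v : 'rV[R]_n => \sum_i v 0 i * A i j).
  apply: class_C_sum; first exact: openT.
  by move=> i; apply: class_CM; [exact: openT|exact: class_C_coord|exact: class_C_cst].
have -> : (fun w : 'rV[R]_n => mulmxr A w 0 j) = fun w => \sum_i w 0 i * A i j.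
  by apply/funext => w /=; rewrite mxE.
exact: dC.
Qed.

Lemma is_derive_line (W : normedModType R) n (h : 'rV[R]_n -> W) (y v : 'rV[R]_n)
    (t : R) : differentiable h (t *: v + y) ->
  is_derive t 1 (fun t => h (t *: v + y)) ('D_v h (t *: v + y)).
Proof.
move=> dh; have /(_ v) dhv := @diff_derivable _ _ _ _ _ _ dh.
have e : (fun k : R => k^-1 *: (((fun t => h (t *: v + y)) \o shift t) (k *: 1)
     - h (t *: v + y))) =
   (fun k : R => k^-1 *: ((h \o shift (t *: v + y)) (k *: v) - h (t *: v + y))).
  by apply/funext => k /=; rewrite [k *: 1]mulr1 scalerDl addrA.
apply: DeriveDef; first by rewrite /derivable e.
by rewrite /derive e.
Qed.

Lemma derive_rowE n (h : 'rV[R]_n -> R) (x v : 'rV[R]_n) :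
  differentiable h x -> 'D_v h x = \sum_i v 0 i * partial i h x.
Proof. by move=> dh; rewrite deriveE// diff_rowE. Qed.

(** Mean value inequality, from the one-variable theorem on a segment.  The norm
    is the maximum of the coordinates, whence the factor n. *)
Lemma mean_value_row n (h : 'rV[R]_n -> R) (x y : 'rV[R]_n) (M : R) : 0 <= M ->
  (forall t, 0 <= t <= 1 -> differentiable h (t *: (x - y) + y) /\
     forall i, `|partial i h (t *: (x - y) + y)| <= M) ->
  `|h x - h y| <= n%:R * M * `|x - y|.
Proof.
move=> M0 hM; set v := x - y.
pose phi t := h (t *: v + y).
have [||t t01] := @MVT R phi (fun t => 'D_v h (t *: v + y)) 0 1 ltr01.
- move=> t; rewrite in_itv/= => /andP[t0 t1].
  by apply: is_derive_line; have [] := hM t _; rewrite // !ltW.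
- apply: derivable_within_continuous => t; rewrite in_itv/= => t01.
  by have [dh _] := hM t t01; have [] := is_derive_line dh.
rewrite /phi scale1r scale0r add0r subr0 mulr1 /v subrK -/v => ->.
have {t01} /hM[dh hMt] : 0 <= t <= 1.
  by move: t01; rewrite in_itv/= => /andP[? ?]; rewrite !ltW.
rewrite derive_rowE// (le_trans (ler_norm_sum _ _ _))//.
apply: (@le_trans _ _ (\sum_(i < n) M * `|v|)).
  by apply: ler_sum => i _; rewrite normrM mulrC ler_pM// normr_coord.
by rewrite sumr_const card_ord -[leLHS]mulr_natl mulrA.
Qed.

End Norms.

Section Jacobian.
Variable R : realType.

Definition jac n p (f : 'rV[R]_n -> 'rV[R]_p) (x : 'rV[R]_n) : 'M[R]_(n, p) :=
  \matrix_(i, j) partial i (fun y => f y 0 j) x.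

Lemma diff_jac n p (f : 'rV[R]_n -> 'rV[R]_p) (x v : 'rV[R]_n) :
  differentiable f x -> 'd f x v = v *m jac f x.
Proof.
move=> df; rewrite -deriveE//.
apply/rowP => j; rewrite derive_mx; last exact: diff_derivable.
rewrite mxE derive_rowE; last first.
  have := @differentiable_comp _ _ _ _ f (fun M : 'rV[R]_p => M 0 j) x df.
  apply; exact: differentiable_coord.
by rewrite mxE; apply: eq_bigr => i _; rewrite mxE.
Qed.

Lemma class_C_det k n m (U : set 'rV[R]_n) (M : 'rV[R]_n -> 'M[R]_m) : open U ->
  (forall i j, class_C k U (fun x => M x i j)) -> class_C k U (fun x => \det (M x)).
Proof.
move=> oU MC; apply: class_C_sum => // s; apply: class_CM => //.
  exact: class_C_cst.
by apply: class_C_prod => // i; exact: MC.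
Qed.

Lemma class_C_invmx k n m (U : set 'rV[R]_n) (M : 'rV[R]_n -> 'M[R]_m) : open U ->
  (forall x, U x -> M x \in unitmx) ->
  (forall i j, class_C k U (fun x => M x i j)) ->
  forall i j, class_C k U (fun x => invmx (M x) i j).
Proof.
move=> oU Mu MC i j.
apply: (@class_C_near _ _ _ _
  (fun x => (\det (M x))^-1 * cofactor (M x) j i)) => //.
  by move=> x Ux; rewrite /invmx Mu// !mxE.
apply: class_CM => //.
  apply: class_CV => //; last exact: class_C_det.
  by move=> x /Mu; rewrite unitmxE unitfE.
apply: class_CM => //; first exact: class_C_cst.
by apply: class_C_det => // i' j'; apply: class_C_near (MC _ _) => // x Ux; rewrite !mxE.
Qed.

End Jacobian.

Section FixedPoint.
Variable R : realType.

Lemma smooth_rV_differentiable n p (U : set 'rV[R]_n) (F : 'rV[R]_n -> 'rV[R]_p) x :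
  smooth_map U F -> U x -> differentiable F x.
Proof.
by move=> FC Ux; apply: rV_differentiable => i; have [/(_ x Ux)] := FC i 1%N.
Qed.

Lemma smooth_partial p (W : set 'rV[R]_p) f j : smooth W f -> smooth W (partial j f).
Proof. by move=> fC k; have [_] := fC k.+1; apply. Qed.

Lemma smooth_jac n p (U : set 'rV[R]_n) (F : 'rV[R]_n -> 'rV[R]_p) i j k :
  open U -> smooth_map U F -> class_C k U (fun x => jac F x i j).
Proof.
move=> oU FC; have [_ /(_ i) C] := FC j k.+1.
by apply: class_C_near C => // x Ux; rewrite mxE.
Qed.

(** Banach's fixed point theorem on a closed ball of the complete space of rows. *)
Lemma ball_fixed_point n (T : 'rV[R]_n -> 'rV[R]_n) (u0 : 'rV[R]_n) (e : R) : 0 < e ->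
  (forall x, `|x - u0| <= e -> `|T x - u0| <= e) ->
  (forall x y, `|x - u0| <= e -> `|y - u0| <= e -> `|T x - T y| <= 2^-1 * `|x - y|) ->
  exists2 x, `|x - u0| <= e & T x = x.
Proof.
move=> e0 Tb Tc; pose X : completeNormedModType R := HB.pack 'rV[R]_n.
pose B : set X := [set x | `|x - u0| <= e].
have funB : set_fun B B T by move=> x; exact: Tb.
pose F : {fun B >-> B} := mkfun_fun funB.
have Fc : is_contraction F.
  exists (2^-1)%:nng; split => /=; first by rewrite invf_lt1// ltr1n.
  by move=> -[x y] [/= Bx By]; exact: Tc.
have cB : closed B.
  rewrite (_ : B = closed_ball_ Num.Def.normr (u0 : X) e); first exact: closed_closed_ball_.
  by apply/funext => x; rewrite /B /closed_ball_/= distrC.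
have [|p Bp pE] := banach_fixed_point Fc cB.
  by exists u0; rewrite /B/= subrr normr0 ltW.
by exists p.
Qed.

End FixedPoint.

Section InverseFunction.
Variable R : realType.

(** A Lipschitz inverse is differentiable wherever the Jacobian is invertible, and
    its partial derivatives are the entries of the inverse Jacobian at Phi.  If Phi
    is of class C^k then so are these entries, hence Phi is of class C^(k+1). *)
Lemma smooth_inverse n (U V : set 'rV[R]_n) (f Phi : 'rV[R]_n -> 'rV[R]_n) (C : R) :
  open U -> open V -> smooth_map U f -> (forall x, U x -> jac f x \in unitmx) ->
  (forall s, V s -> U (Phi s)) -> (forall s, V s -> f (Phi s) = s) ->
  0 < C -> (forall s t, V s -> V t -> `|Phi s - Phi t| <= C * `|s - t|) ->
  smooth_map V Phi.
Proof.
move=> oU oV fC Ju VU fK C0 PhiL.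
have dPhi s : V s -> differentiable Phi s /\
    ('d Phi s = mulmxr (invmx (jac f (Phi s))) :> ('rV[R]_n -> 'rV[R]_n)).
  move=> Vs; set x := Phi s; have Ux : U x by exact: VU.
  have [K K0 HK] := normr_mulmx (invmx (jac f x)).
  apply: differentiable_eps; first exact: mulmx_row_continuous.
  move=> e e0; pose eta := e / (K * C).
  have eta0 : 0 < eta by rewrite divr_gt0// mulr_gt0.
  have df := smooth_rV_differentiable fC Ux.
  have /nbhs_normP[/= d d0 Hd] := differentiable_epsP df eta0.
  have Vn : \forall h \near (0 : 'rV[R]_n), V (h + s).
    have : \near s, V s := open_nbhs_nbhs (conj oV Vs).
    by rewrite (near_shift 0) subr0; apply: filterS => h /=.
  have /nbhs_normP[/= d1 d10 Hd1] := Vn.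
  apply/nbhs_normP; exists (Num.min d1 (d / C)) => /=.
    by rewrite lt_min d10 divr_gt0.
  move=> h; rewrite /ball_/= sub0r normrN lt_min => /andP[hd1 hd].
  have Vhs : V (h + s) by apply: Hd1; rewrite /ball_/= sub0r normrN.
  set k := Phi (h + s) - x.
  have kL : `|k| <= C * `|h| by rewrite (le_trans (PhiL _ _ Vhs Vs))// addrK.
  have : `|f (k + x) - (f x + 'd f x k)| <= eta * `|k|.
    apply: Hd; rewrite /ball_/= sub0r normrN (le_lt_trans kL)//.
    by rewrite mulrC -ltr_pdivlMr.
  rewrite /k subrK -/k /x !fK// -/x opprD addrA addrK diff_jac// => Hk.
  rewrite (_ : _ - _ = - ((h - k *m jac f x) *m invmx (jac f x))); last first.
    rewrite mulmxBl mulmxK ?Ju// opprB opprD addrA; congr (_ - _).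
  rewrite normrN (le_trans (HK _))// (@le_trans _ _ (K * (eta * `|k|)))//.
    by rewrite ler_pM2l.
  apply: (@le_trans _ _ (K * (eta * (C * `|h|)))).
    by rewrite ler_pM2l// ler_pM2l.
  by rewrite /eta le_eqVlt; apply/orP; left; apply/eqP; field; rewrite !gt_eqF.
move=> i k; elim: k i => [|k IH] i.
  move=> s Vs; have [ds _] := dPhi s Vs.
  have := @continuous_comp _ _ _ Phi (fun M : 'rV[R]_n => M 0 i) s.
  by apply; [exact: differentiable_continuous|exact: coord_continuous].
split=> [s Vs|j].
  have [ds _] := dPhi s Vs.
  have := @differentiable_comp _ _ _ _ Phi (fun M : 'rV[R]_n => M 0 i) s ds.
  apply; exact: differentiable_coord.
apply: (@class_C_near _ _ _ _ (fun s => invmx (jac f (Phi s)) j i)) => //.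
  move=> s Vs; have [ds Es] := dPhi s Vs.
  have := deriveE (delta_mx 0 j) ds; rewrite derive_mx; last exact: diff_derivable.
  move=> /rowP/(_ i); rewrite mxE Es /partial => ->.
  by rewrite /= -rowE mxE.
apply: (@class_C_comp R n n k V U Phi (fun x => invmx (jac f x) j i)) => //.
by apply: class_C_invmx => // i' j'; exact: smooth_jac.
Qed.

(** Let A be the inverse Jacobian at u0.  The map g(x) = x - f(x) A has zero
    derivative at u0, so it halves distances on a small ball, and f(x) = y says
    that x is a fixed point of x |-> g(x) + y A. *)
Lemma inverse_function n (D : set 'rV[R]_n) (f : 'rV[R]_n -> 'rV[R]_n) u0 :
  open D -> smooth_map D f -> D u0 -> jac f u0 \in unitmx ->
  exists U V Phi, [/\ U u0, U `<=` D & coordinates U V f Phi].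
Proof.
move=> oD fC Du0 Ju0; set A := invmx (jac f u0).
have Au : A \in unitmx by rewrite unitmx_inv.
pose h j (x : 'rV[R]_n) : R := x 0 j - \sum_i f x 0 i * A i j.
have hE x j : (x - f x *m A) 0 j = h j x by rewrite /h !mxE.
have hC k j : class_C k D (h j).
  apply: (@class_C_near _ _ _ _ (fun x => x 0 j + (-1) * \sum_i f x 0 i * A i j)) => //.
    by move=> x _; rewrite mulN1r.
  apply: class_CD => //; first exact: class_C_coord.
  apply: class_CM => //; first exact: class_C_cst.
  apply: class_C_sum => // i; apply: class_CM => //; first exact: fC.
  exact: class_C_cst.
have dh0 i j : partial i (h j) u0 = 0.
  have d1 k : is_derive u0 (delta_mx 0 i : 'rV[R]_n) (fun x => f x 0 k * A k j)
      (jac f u0 i k * A k j).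
    have := is_derive_mul (smooth_is_derive _ (fC k) Du0)
      (is_derive_cst (A k j) u0 (delta_mx 0 i : 'rV[R]_n)).
    by rewrite mulr0 addr0 !mxE.
  have [_] := is_derive_sub (is_derive_coord u0 (delta_mx 0 i) j) (is_derive_bigsum d1).
  rewrite /partial -/(h j) => ->.
  have <- : (1%:M : 'M[R]_n) i j = \sum_k jac f u0 i k * A k j.
    by rewrite -(mulmxV Ju0) mxE.
  by rewrite !mxE eqxx/= eq_sym subrr.
(* Bounds the partial derivatives of g so that the factor n of the mean value
   inequality still leaves 1/2. *)
pose M := (2 * n.+1%:R)^-1 : R.
have M0 : 0 < M by rewrite invr_gt0 mulr_gt0.
have near_u0 : \forall x \near u0, D x /\ jac f x \in unitmx /\
    forall ij : 'I_n * 'I_n, `|partial ij.1 (h ij.2) x| < M.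
  have Dn : \near u0, D u0 := open_nbhs_nbhs (conj oD Du0).
  have Jn : \forall x \near u0, jac f x \in unitmx.
    have dC : {for u0, continuous (fun x => \det (jac f x))}.
      apply: (@class_C_det R 0 _ _ D) => // i j; exact: smooth_jac.
    have : \forall x \near u0, \det (jac f x) != 0.
      apply: continuous_near_neq0 dC _; move: Ju0; by rewrite unitmxE unitfE.
    by apply: filterS => x; rewrite unitmxE unitfE.
  have Pn : \forall x \near u0,
      forall ij : 'I_n * 'I_n, `|partial ij.1 (h ij.2) x| < M.
    have := @filter_forall _ ('I_n * 'I_n)%type
      (fun ij x => `|partial ij.1 (h ij.2) x| < M) (nbhs u0) _.
    apply=> -[i j] /=.
    have [_ /(_ i) pC] := hC 1%N j.
    have := pC u0 Du0; rewrite /prop_for /continuous_at dh0 => /cvgr0_norm_lt; exact.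
  by apply: filterS3 Dn Jn Pn => x ? ? ?; split.
have /nbhs_normP[/= e1 e10 He1] := near_u0.
pose e := e1 / 2; have e0 : 0 < e by rewrite divr_gt0.
have {He1} He x : `|x - u0| <= e -> [/\ D x, jac f x \in unitmx &
    forall i j, `|partial i (h j) x| <= M].
  move=> xe; have [|Dx [Jx Px]] := He1 x.
    rewrite /ball_/= distrC (le_lt_trans xe)// /e ltr_pdivrMr// ltr_pMr//.
    by rewrite ltr1n.
  by split=> // i j; exact: ltW (Px (i, j)).
pose g (x : 'rV[R]_n) : 'rV[R]_n := x - f x *m A.
have gL (x y : 'rV[R]_n) : `|x - u0| <= e -> `|y - u0| <= e -> `|g x - g y| <= 2^-1 * `|x - y|.
  move=> xe ye; apply: normr_row_le; first by rewrite mulr_ge0.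
  move=> j; rewrite mxE [X in _ + X]mxE !hE.
  have := @mean_value_row _ _ (h j) x y M (ltW M0) _.
  move=> /(_ _)/le_trans; apply.
    move=> t /andP[t0 t1].
    have te : `|t *: (x - y) + y - u0| <= e.
      rewrite (_ : _ - u0 = t *: (x - u0) + (1 - t) *: (y - u0)); last first.
        by apply/rowP => k; rewrite !mxE; ring.
      rewrite (le_trans (ler_normD _ _))// !normrZ !ger0_norm ?subr_ge0//.
      rewrite [leRHS](_ : e = t * e + (1 - t) * e); last by ring.
      rewrite lerD// ler_wpM2l//.
      by rewrite subr_ge0.
    have [Dt _ Pt] := He _ te; split; last by move=> i; exact: Pt.
    by have [/(_ _ Dt)] := hC 1%N j.
  rewrite ler_wpM2r// /M invfM mulrCA ler_piMr// ler_pdivrMr// mul1r ler_nat.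
  by [].
have fx (x y : 'rV[R]_n) : x - y = (g x - g y) + (f x - f y) *m A.
  rewrite /g mulmxBl; move: (f x *m A) (f y *m A) => a b.
  by apply/rowP => k; rewrite !mxE; ring.
have half (x y : 'rV[R]_n) (d : R) : `|x - y| <= 2^-1 * `|x - y| + d -> `|x - y| <= 2 * d.
  by move=> H; lra.
pose V := [set y : 'rV[R]_n | `|(y - f u0) *m A| < e / 2].
pose U := [set x : 'rV[R]_n | `|x - u0| < e /\ V (f x)].
pose sol (y x : 'rV[R]_n) := `|x - u0| <= e /\ f x = y.
pose Phi y := get (sol y).
have PhiP y : V y -> sol y (Phi y).
  move=> Vy; rewrite /Phi; apply: getPex.
  pose T (x : 'rV[R]_n) : 'rV[R]_n := g x + y *m A.
  have Tu x : T x - u0 = (g x - g u0) + (y - f u0) *m A.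
    rewrite /T /g mulmxBl; move: (f x *m A) (f u0 *m A) (y *m A) => a b c.
    by apply/rowP => k; rewrite !mxE; ring.
  have [||x xe Tx] := @ball_fixed_point _ _ T u0 e e0.
  - move=> x xe; rewrite Tu (le_trans (ler_normD _ _))//.
    have := gL x u0 xe; rewrite subrr normr0 => /(_ (ltW e0)) H1.
    by move: Vy; rewrite /V/= => Vy; lra.
  - by move=> x z xe ze; rewrite /T opprD addrACA subrr addr0; exact: gL.
  exists x; split => //.
  have : (y - f x) *m A = 0.
    rewrite mulmxBl; apply/(addrI x); rewrite addr0 -[RHS]Tx /T /g.
    move: (f x *m A) (y *m A) => a c.
    by apply/rowP => k; rewrite !mxE; ring.
  move=> /(congr1 (mulmxr (jac f u0))) /=; rewrite mulmxKV// mul0mx => /eqP.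
  by rewrite subr_eq0 => /eqP.
have dist x y : `|x - u0| <= e -> `|y - u0| <= e ->
    `|x - y| <= 2 * `|(f x - f y) *m A|.
  move=> xe ye; apply: half.
  by rewrite [in leLHS]fx (le_trans (ler_normD _ _))// lerD2r gL.
have PhiU y : V y -> U (Phi y).
  move=> Vy; have [Pe fP] := PhiP y Vy; split; last by rewrite fP.
  have := dist _ u0 Pe; rewrite subrr normr0 fP => /(_ (ltW e0)) H.
  by move: Vy; rewrite /V/= => Vy; lra.
have PhiK x : U x -> Phi (f x) = x.
  move=> [xe Vx]; have [Pe fP] := PhiP _ Vx; apply/eqP.
  rewrite -subr_eq0 -normr_le0 (le_trans (dist _ _ Pe (ltW xe)))//.
  by rewrite fP subrr mul0mx normr0 mulr0.
have UD : U `<=` D by move=> x [xe _]; have [] := He x (ltW xe).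
have oV : open V.
  have Fc : continuous (fun y : 'rV[R]_n => `|(y - f u0) *m A|).
    move=> y; have := @continuous_comp _ _ _ 
      (fun y : 'rV[R]_n => ((y - f u0) *m A : 'rV[R]_n)) (fun v : 'rV[R]_n => `|v|) y; apply; last exact: norm_continuous.
    have := @continuous_comp _ _ _ 
      (fun y : 'rV[R]_n => (y - f u0 : 'rV[R]_n)) (mulmxr A) y.
    apply; last exact: mulmx_row_continuous.
    have := @continuousB R 'rV[R]_n 'rV[R]_n id (cst (f u0)) y.
    by apply; [exact: cvg_id|exact: cst_continuous].
  apply: (@open_comp _ _ (fun y : 'rV[R]_n => `|(y - f u0) *m A|)
    [set r | r < e / 2]); last exact: open_lt.
  by move=> y _; exact: Fc.
have oU : open U.
  rewrite openE => x [xe Vx]; apply: filterI.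
    have := open_nbhs_nbhs (conj (@ball_open _ 'rV[R]_n u0 e) _ : open_nbhs x _).
    rewrite -ball_normE/= distrC => /(_ xe).
    by apply: filterS => y /=; rewrite distrC.
  have df := smooth_rV_differentiable fC (UD _ (conj xe Vx)).
  exact: (differentiable_continuous df (open_nbhs_nbhs (conj oV Vx))).
have [K K0 HK] := normr_mulmx A.
exists U, V, Phi; split => //.
  by split; rewrite /V/= subrr ?mul0mx normr0 ?divr_gt0.
have fU : smooth_map U f by move=> i k; apply: class_CS (fC i k).
have fK y : V y -> f (Phi y) = y by move=> /PhiP[].
split=> //; last by split=> // x [].
split=> //; apply: (@smooth_inverse n U V f Phi (2 * K)) => //.
- by move=> x [xe _]; have [] := He x (ltW xe).
- by rewrite mulr_gt0.
move=> s t Vs Vt; have [Ps fs] := PhiP s Vs; have [Pt ft] := PhiP t Vt.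
by rewrite (le_trans (dist _ _ Ps Pt))// fs ft -mulrA ler_pM2l.
Qed.
End InverseFunction.

(** * Symmetry of second derivatives *)

Section Schwarz.
Variable R : realType.

Lemma is_derive_segment n (U : set 'rV[R]_n) (f : 'rV[R]_n -> R) (x v : 'rV[R]_n) (h : R) :
  0 < h -> (forall t, 0 <= t <= h -> U (t *: v + x)) ->
  (forall y, U y -> differentiable f y) ->
  exists2 c, 0 <= c <= h & f (h *: v + x) - f x = 'D_v f (c *: v + x) * h.
Proof.
move=> h0 hU fd.
have dl t : 0 <= t <= h ->
    is_derive t 1 (fun t => f (t *: v + x)) ('D_v f (t *: v + x)).
  by move=> /hU /fd; exact: is_derive_line.
have [||c ch E] := @MVT R (fun t => f (t *: v + x)) (fun t => 'D_v f (t *: v + x)) 0 h h0.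
- by move=> t; rewrite in_itv/= => /andP[t0 th]; apply: dl; rewrite !ltW.
- apply: derivable_within_continuous => t; rewrite in_itv/= => th.
  by have [] := dl t th.
exists c; first by move: ch; rewrite in_itv/= => /andP[? ?]; rewrite !ltW.
by move: E; rewrite scale0r add0r subr0.
Qed.

(** Two applications of the mean value theorem, first in direction i to the
    increment of f in direction j, then in direction j. *)
Lemma second_difference n (x : 'rV[R]_n) (d h : R) (f : 'rV[R]_n -> R) (i j : 'I_n) :
  0 < h -> 2 * h < d -> smooth (ball x d) f ->
  exists2 z, ball x d z &
    f (h *: delta_mx 0 i + (h *: delta_mx 0 j + x)) - f (h *: delta_mx 0 i + x)
    - f (h *: delta_mx 0 j + x) + f x = partial j (partial i f) z * h ^+ 2.
Proof.
move=> h0 hd fC; set u : 'rV[R]_n := delta_mx 0 i; set v : 'rV[R]_n := delta_mx 0 j.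
have delta1 k : `|delta_mx 0 k : 'rV[R]_n| <= 1.
  apply: normr_row_le => // l; rewrite mxE.
  by case: (_ && _); rewrite ?normr1 ?normr0.
have inB s t : 0 <= s <= h -> 0 <= t <= h -> ball x d (s *: u + (t *: v + x)).
  move=> /andP[s0 sh] /andP[t0 th]; rewrite -ball_normE/= distrC addrA addrK.
  rewrite (le_lt_trans (ler_normD _ _))// !normrZ !ger0_norm//.
  have := ler_pM s0 (normr_ge0 u) sh (delta1 i).
  have := ler_pM t0 (normr_ge0 v) th (delta1 j).
  lra.
have hh : 0 <= h <= h by rewrite lexx ltW.
have h00 : 0 <= (0 : R) <= h by rewrite lexx ltW.
have fd y : ball x d y -> differentiable f y by have [fd _] := fC 1%N; exact: fd.
pose g y := f (h *: v + y) - f y.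
have [c ch cE] : exists2 c, 0 <= c <= h & g (h *: u + x) - g x =
    (partial i f (h *: v + (c *: u + x)) - partial i f (c *: u + x)) * h.
  have dg t : 0 <= t <= h -> is_derive t 1 (fun t => g (t *: u + x))
      (partial i f (h *: v + (t *: u + x)) - partial i f (t *: u + x)).
    move=> th; apply: is_derive_sub; last first.
      apply: is_derive_line; apply: fd.
      by have := inB t 0 th h00; rewrite scale0r add0r.
    have := @is_derive_line R R n f (h *: v + x) u t (fd _ (inB t h th hh)).
    rewrite addrCA; congr is_derive.
    by apply/funext => s; rewrite addrCA.
  have [||c ch E] := @MVT R (fun t => g (t *: u + x)) (fun t =>
    partial i f (h *: v + (t *: u + x)) - partial i f (t *: u + x)) 0 h h0.
  - by move=> t; rewrite in_itv/= => /andP[t0 th]; apply: dg; rewrite !ltW.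
  - apply: derivable_within_continuous => t; rewrite in_itv/= => th.
    by have [] := dg t th.
  exists c; first by move: ch; rewrite in_itv/= => /andP[? ?]; rewrite !ltW.
  by move: E; rewrite scale0r add0r subr0.
have [] := @is_derive_segment n (ball x d) (partial i f) (c *: u + x) v h h0.
- by move=> t th; rewrite addrCA; exact: inB.
- by have [_ /(_ i) [pd _]] := fC 2%N; exact: pd.
move=> e eh eE; exists (e *: v + (c *: u + x)); first by rewrite addrCA; exact: inB.
rewrite expr2 mulrA /partial -eE -cE /g [h *: v + (h *: u + x)]addrCA.
by ring.
Qed.

(** Two distinct numbers have no common approximation within half their distance. *)
Lemma far_from_both (a b p : R) :
  `|a - p| < `|a - b| / 2 -> ~ `|b - p| < `|a - b| / 2.
Proof. by have := ler_distD p a b; rewrite [`|p - b|]distrC => H H1 H2; lra. Qed.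

(** The second difference is symmetric in i and j, so the two mixed derivatives take
    a common value, at two points arbitrarily close to x. *)
Lemma partialC n (U : set 'rV[R]_n) (f : 'rV[R]_n -> R) (x : 'rV[R]_n) (i j : 'I_n) :
  open U -> smooth U f -> U x ->
  partial i (partial j f) x = partial j (partial i f) x.
Proof.
move=> oU fC Ux; apply/eqP/negPn/negP => neq.
set a := partial i (partial j f) x; set b := partial j (partial i f) x.
have ab0 : 0 < `|a - b| / 2 by rewrite divr_gt0// normr_gt0 subr_eq0.
have pc k l : {for x, continuous (partial k (partial l f))}.
  by have [_ /(_ l) [_ /(_ k)]] := fC 2%N; exact.
have Un : \near x, U x := open_nbhs_nbhs (conj oU Ux).
have near_x : \forall y \near x, U y /\ `|a - partial i (partial j f) y| < `|a - b| / 2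
   /\ `|b - partial j (partial i f) y| < `|a - b| / 2.
  have H1 : \forall y \near x, `|a - partial i (partial j f) y| < `|a - b| / 2.
    by move/cvgrPdist_lt : (pc i j) => /(_ _ ab0).
  have H2 : \forall y \near x, `|b - partial j (partial i f) y| < `|a - b| / 2.
    by move/cvgrPdist_lt : (pc j i) => /(_ _ ab0).
  by apply: filterS3 Un H1 H2 => y ? ? ?; split.
have /nbhs_ballP[/= d d0 Hd] := near_x.
have fB : smooth (ball x d) f by move=> k; apply: class_CS (fC k) => y /Hd[].
have h0 : 0 < d / 3 by rewrite divr_gt0.
have hd : 2 * (d / 3) < d by clear -d0; lra.
have [z1 /Hd[_ [_ z1b]] E1] := second_difference i j h0 hd fB.
have [z2 /Hd[_ [z2a _]] E2] := second_difference j i h0 hd fB.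
have E : partial j (partial i f) z1 = partial i (partial j f) z2.
  apply: (@mulIf _ ((d / 3) ^+ 2)); first by rewrite expf_neq0// gt_eqF.
  apply: etrans (esym E1) (etrans _ E2).
  congr (_ + _); rewrite addrAC; congr (f _ - _ - _); exact: addrCA.
by move: z1b; rewrite E; exact: (far_from_both z2a).
Qed.

End Schwarz.

(** * Algebra of the critical equation *)

Section CauchySystem.
Variable F : fieldType.

(** Multiplying by \prod_l (q - b_l) gives a polynomial in q of degree at most n with
    n + 1 roots; its value at b_m is c_m times a nonzero factor. *)
Lemma cauchy_system n (b c : 'I_n -> F) (c0 : F) (q : 'I_n.+1 -> F) :
  injective b -> injective q -> (forall k m, q k != b m) ->
  (forall k, c0 + \sum_m c m / (q k - b m) = 0) -> c0 = 0 /\ forall m, c m = 0.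
Proof.
move=> bi qi qb H.
pose Pi (P : pred 'I_n) : {poly F} := \prod_(l | P l) ('X - (b l)%:P).
pose p := c0 *: Pi xpredT + \sum_m c m *: Pi (fun l => l != m).
have PiE P x : (Pi P).[x] = \prod_(l | P l) (x - b l).
  by rewrite /Pi horner_prod; apply: eq_bigr => l _; rewrite hornerXsubC.
have szPi P : (size (Pi P) <= n.+1)%N.
  rewrite (leq_trans (size_prod_leq _ _))//.
  rewrite (eq_bigr (fun=> 2%N)) => [|l _]; last by rewrite size_XsubC.
  rewrite sum_nat_const muln2 -addnn subSn ?leq_addr// addnK ltnS.
  by rewrite -[leqRHS]card_ord max_card.
have p0 : p = 0.
  apply/eqP/negPn/negP => p0.
  have := @max_poly_roots _ p (codom q) p0; rewrite size_codom card_ord.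
  have -> : uniq (codom q) by apply/injectiveP.
  have -> : all (root p) (codom q).
    apply/allP => _ /codomP[k ->]; rewrite rootE /p !hornerE horner_sum PiE.
    suff -> : \sum_m (c m *: Pi (fun l => l != m)).[q k] =
        (\prod_l (q k - b l)) * \sum_m c m / (q k - b m).
      by rewrite mulrC -mulrDr H mulr0.
    rewrite mulr_sumr; apply: eq_bigr => m _; rewrite hornerZ PiE.
    rewrite [in RHS](bigD1 m)//=; move: (qb k m); rewrite -subr_eq0 => qbm.
    by field.
  move=> /(_ isT isT); apply/negP; rewrite -leqNgt.
  rewrite (leq_trans (size_polyD _ _))// geq_max (leq_trans (size_scale_leq _ _))//=.
  apply: (leq_trans (size_sum _ _ _)); apply/bigmax_leqP => m _.
  exact: leq_trans (size_scale_leq _ _) (szPi _).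
have c_0 m : c m = 0.
  have := congr1 (horner^~ (b m)) p0; rewrite /p !hornerE horner_sum PiE.
  rewrite (bigD1 m)//= subrr mul0r mulr0 add0r (bigD1 m)//= big1; last first.
    move=> l lm; rewrite hornerZ PiE (bigD1 m)/=; last by rewrite eq_sym.
    by rewrite subrr mul0r mulr0.
  rewrite addr0 hornerZ PiE => /eqP; rewrite mulf_eq0 => /orP[/eqP//|].
  rewrite prodf_seq_eq0 => /hasP[l _ /andP[lm]].
  by rewrite subr_eq0 => /eqP/bi/esym/eqP; rewrite (negPf lm).
split=> //; have := H ord0; rewrite big1 ?addr0// => m _.
by rewrite c_0 mul0r.
Qed.

End CauchySystem.

Section CriticalIdentities.
Variables (R : realType) (n : nat).
Implicit Types (b : 'rV[R]_n) (beta : 'I_n -> R) (p q alpha : R).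

Lemma sqr1_neq0 q : 1 + q ^+ 2 != 0.
Proof. by rewrite gt_eqF// ltr_pwDl// sqr_ge0. Qed.

(** Expand (1 + b^2) / (q - b) = (1 + q^2) / (q - b) - (q + b) and use the critical
    equation. *)
Lemma crit_sum b q : critical_root b q ->
  \sum_m (1 + b 0 m ^+ 2) / (q - b 0 m) = q - \sum_m b 0 m.
Proof.
move=> [qb E].
have -> : \sum_m (1 + b 0 m ^+ 2) / (q - b 0 m) =
    \sum_m ((1 + q ^+ 2) * (q - b 0 m)^-1 - (q + b 0 m)).
  apply: eq_bigr => m _; have := qb m; rewrite -subr_eq0 => qbm; by field.
rewrite sumrB -mulr_sumr -E big_split/= sumr_const card_ord -mulr_natr -natr1.
have h := sqr1_neq0 q; move: (\sum_m b 0 m) => s; by field.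
Qed.

(** The left side is a Cauchy expression in q, the right side contains the
    logarithmic derivative of a critical value when alpha and beta are the
    derivatives of log s and of b.  With p = 0 this relates the system to its
    diagonal form; with p = q_j it yields the derivatives of b along r^j. *)
Lemma crit_shift b beta p q alpha : critical_root b q ->
  ((p - \sum_m b 0 m) * alpha - \sum_m beta m)
  + \sum_m ((p - b 0 m) * beta m - (1 + b 0 m ^+ 2) * alpha) / (q - b 0 m)
  = (p - q) * (alpha + \sum_m beta m / (q - b 0 m)).
Proof.
move=> qc; have [qb _] := qc.
have -> : \sum_m ((p - b 0 m) * beta m - (1 + b 0 m ^+ 2) * alpha) / (q - b 0 m) =
   \sum_m ((p - q) * (beta m / (q - b 0 m)) + beta m - alpha * ((1 + b 0 m ^+ 2) / (q - b 0 m))).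
  apply: eq_bigr => m _; have := qb m; rewrite -subr_eq0 => qbm; by field.
rewrite sumrB big_split/= -!mulr_sumr crit_sum//.
move: (\sum_m beta m / _) (\sum_m beta m) (\sum_m b 0 m) => s1 s2 s3; ring.
Qed.

(** The derivative in q of the critical equation, left side minus right side. *)
Definition dcrit b q : R :=
  n.+1%:R * (1 - q ^+ 2) / (1 + q ^+ 2) ^+ 2 + \sum_m (q - b 0 m) ^- 2.

(** The roots are simple.  If the derivative vanished at q_i, then the divided
    differences of the critical equation between q_i and every q_k, including
    q_i itself, would vanish; after multiplication by 1 + q_k^2 they form a Cauchy
    system with the nonzero coefficients c_m = (1 + b_m^2) / (q_i - b_m). *)
Lemma dcrit_neq0 b (q : 'I_n.+1 -> R) i : (0 < n)%N ->
  injective (fun m => b 0 m) -> injective q ->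
  (forall k, critical_root b (q k)) -> dcrit b (q i) != 0.
Proof.
move=> n0 bi qi qc; apply/eqP => D0.
have [qib Ei] := qc i.
pose c m := (1 + b 0 m ^+ 2) / (q i - b 0 m).
pose c0 := n.+1%:R / (1 + q i ^+ 2) + \sum_m b 0 m / (q i - b 0 m).
have [] := @cauchy_system R n (fun m => b 0 m) c c0 q bi qi (fun k => (qc k).1).
  move=> k.
  have E : n.+1%:R * (1 - q k * q i) / (1 + q i ^+ 2)
      + (1 + q k ^+ 2) * \sum_m ((q k - b 0 m) * (q i - b 0 m))^-1 = 0.
    have [->|ki] := eqVneq k i.
      transitivity ((1 + q i ^+ 2) * dcrit b (q i)); last by rewrite D0 mulr0.
      have -> : \sum_m ((q i - b 0 m) * (q i - b 0 m))^-1 = \sum_m (q i - b 0 m) ^- 2.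
        by apply: eq_bigr => m _; rewrite expr2.
      rewrite /dcrit; move: (\sum_m _) => s; by field; exact: sqr1_neq0.
    have qki : q k - q i != 0.
      by rewrite subr_eq0; apply: contra_neq ki => /qi.
    apply: (mulfI qki); rewrite mulr0.
    have [qkb Ek] := qc k.
    have -> : \sum_m ((q k - b 0 m) * (q i - b 0 m))^-1 =
        (q k - q i)^-1 * \sum_m ((q i - b 0 m)^-1 - (q k - b 0 m)^-1).
      rewrite mulr_sumr; apply: eq_bigr => m _.
      have := qib m; have := qkb m; rewrite -subr_eq0 => h2; rewrite -subr_eq0 => h1.
      by field; rewrite h1 h2.
    rewrite sumrB -Ei -Ek.
    by field; rewrite qki !sqr1_neq0.
  apply: etrans E; rewrite /c0 /c.
  have -> : \sum_m (1 + b 0 m ^+ 2) / (q i - b 0 m) / (q k - b 0 m) =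
      \sum_m ((1 + q k ^+ 2) * ((q k - b 0 m) * (q i - b 0 m))^-1
              - q k * (q i - b 0 m)^-1 - b 0 m / (q i - b 0 m)).
    apply: eq_bigr => m _; have := (qc k).1 m; have := qib m.
    rewrite -subr_eq0 => h1; rewrite -subr_eq0 => h2; by field; rewrite h1 h2.
  rewrite !sumrB -!mulr_sumr -Ei.
  move: (\sum_m _) (\sum_m _) => s1 s2.
  by field; exact: sqr1_neq0.
move=> _ /(_ (Ordinal n0)) /eqP; rewrite /c mulf_eq0 (negPf (sqr1_neq0 _)) invr_eq0.
by rewrite subr_eq0 (negPf (qib _)).
Qed.

(** Partial fractions in b_m, then the critical equations at p and at q. *)
Lemma crit_motion b p q : p != q -> critical_root b p -> critical_root b q ->
  \sum_m (1 + b 0 m ^+ 2) / (p - b 0 m) / (q - b 0 m) ^+ 2 =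
  dcrit b q * ((1 + q ^+ 2) / (p - q)).
Proof.
rewrite -subr_eq0 => pq [pb Ep] [qb Eq].
have -> : \sum_m (1 + b 0 m ^+ 2) / (p - b 0 m) / (q - b 0 m) ^+ 2 =
    \sum_m ((1 + p ^+ 2) / (p - q) ^+ 2 * (p - b 0 m)^-1
      + (1 - (1 + p ^+ 2) / (p - q) ^+ 2) * (q - b 0 m)^-1
      + (1 + q ^+ 2) / (p - q) * (q - b 0 m) ^- 2).
  apply: eq_bigr => m _; have := pb m; have := qb m.
  rewrite -subr_eq0 => h1; rewrite -subr_eq0 => h2; by field; rewrite ?h1 ?h2 ?pq.
rewrite !big_split/= -!mulr_sumr -Ep -Eq /dcrit.
move: (\sum_m _) => s.
by field; rewrite pq !sqr1_neq0.
Qed.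

End CriticalIdentities.

(** * Critical values and the diagonal form *)

Section LogarithmicDerivatives.
Variables (R : realType) (V : normedModType R).
Implicit Types (f g : V -> R) (x v : V).

Lemma is_derive_prodlog (I : Type) (l : seq I) (f : I -> V -> R) x v (df : I -> R) :
  (forall i, f i x != 0) -> (forall i, is_derive x v (f i) (df i)) ->
  is_derive x v (fun y => \prod_(i <- l) f i y)
    (\prod_(i <- l) f i x * \sum_(i <- l) df i / f i x).
Proof.
move=> f0 hf; elim: l => [|i l IH].
  rewrite !big_nil mulr0.
  have -> : (fun y => \prod_(i <- [::]) f i y) = cst 1.
    by apply/funext => y; rewrite big_nil.
  exact: is_derive_cst.
have -> : (fun y => \prod_(j <- i :: l) f j y) =
    (fun y => f i y * \prod_(j <- l) f j y).
  by apply/funext => y; rewrite big_cons.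
apply: is_derive_eq (is_derive_mul (hf i) IH) _.
rewrite !big_cons; move: (\sum_(j <- l) _) (\prod_(j <- l) _) => s p.
by have := f0 i => fi; field.
Qed.

Lemma is_derive_powR f x v (df a : R) : 0 < f x ->
  is_derive x v f df ->
  is_derive x v (fun y => f y `^ a) (f x `^ a * (a * df / f x)).
Proof.
move=> f0 hf; apply: is_derive_eq (is_derive_comp1 (is_derive1_powR a f0) hf) _.
have fn := lt0r_neq0 f0.
rewrite (@powRB _ (f x) a 1) ?fn ?implybT//. rewrite powRr1 ?ltW//; by field.
Qed.

Lemma is_derive_sqrt f x v (df : R) : 0 < f x ->
  is_derive x v f df ->
  is_derive x v (fun y => Num.sqrt (f y)) (df / (2 * Num.sqrt (f x))).
Proof.
move=> f0 hf; apply: is_derive_eq (is_derive_comp1 (is_derive1_sqrt f0) hf) _.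
by rewrite mulrC.
Qed.

(** The derivative dq of the critical point enters with the factor F_q = 0 and drops
    out of the derivative of the critical value. *)
Lemma is_derive_critical_value n (s q : V -> R) (b : V -> 'rV[R]_n) x v
    (ds dq : R) (db : 'I_n -> R) :
  0 < s x -> critical_root (b x) (q x) ->
  is_derive x v s ds -> is_derive x v q dq ->
  (forall m, is_derive x v (fun y => b y 0 m) (db m)) ->
  is_derive x v
    (fun y => (s y)^-1 * (1 + q y ^+ 2) `^ (- (n.+1%:R / 2))
              * \prod_(m < n) (q y - b y 0 m))
    (- ((s x)^-1 * (1 + q x ^+ 2) `^ (- (n.+1%:R / 2))
              * \prod_(m < n) (q x - b x 0 m))
     * (ds / s x + \sum_m db m / (q x - b x 0 m))).
Proof.
move=> s0 [qb qE] hs hq hb.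
have q1 : 0 < 1 + q x ^+ 2 by rewrite ltr_pwDl// sqr_ge0.
have hp := is_derive_powR (- (n.+1%:R / 2)) q1
  (is_derive_add (is_derive_cst (1 : R) x v) (is_derive_exp 2 hq)).
have qb0 m : q x - b x 0 m != 0 by rewrite subr_eq0.
have hprod := is_derive_prodlog (index_enum 'I_n) qb0 (fun m => is_derive_sub hq (hb m)).
apply: is_derive_eq
  (is_derive_mul (is_derive_mul (is_derive_inv (lt0r_neq0 s0) hs) hp) hprod) _.
have -> : \sum_m (dq - db m) / (q x - b x 0 m) =
    dq * (n.+1%:R * (q x / (1 + q x ^+ 2))) - \sum_m db m / (q x - b x 0 m).
  by rewrite qE mulr_sumr -sumrB; apply: eq_bigr => m _; rewrite mulrBl.
move: (\sum_m _) (\prod_m _) (_ `^ _) => S P W /=.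
have := lt0r_neq0 s0; have := lt0r_neq0 q1 => h1 h2.
by field; rewrite h1 h2.
Qed.

(** The differential of the critical equation with respect to both q and b. *)
Lemma is_derive_critical n (q : V -> R) (b : V -> 'rV[R]_n) x v (dq : R) (db : 'I_n -> R) :
  (forall m, q x != b x 0 m) -> is_derive x v q dq ->
  (forall m, is_derive x v (fun y => b y 0 m) (db m)) ->
  is_derive x v (fun y => n.+1%:R * (q y / (1 + q y ^+ 2)) - \sum_m (q y - b y 0 m)^-1)
    (dcrit (b x) (q x) * dq - \sum_m db m / (q x - b x 0 m) ^+ 2).
Proof.
move=> qb hq hb.
have nz m : q x - b x 0 m != 0 by rewrite subr_eq0.
have q1 := sqr1_neq0 (q x).
have hs : is_derive x v (fun y => 1 + q y ^+ 2) _ :=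
  is_derive_add (is_derive_cst (1 : R) x v) (is_derive_exp 2 hq).
have h1 := is_derive_mul (is_derive_cst (n.+1%:R : R) x v)
  (is_derive_mul hq (is_derive_inv (f := fun y => 1 + q y ^+ 2) q1 hs)).
have h2 := is_derive_bigsum (fun m => is_derive_inv
  (f := fun y => q y - b y 0 m) (nz m) (is_derive_sub hq (hb m))).
apply: is_derive_eq (is_derive_sub h1 h2) _.
have -> : \sum_(m < n) - (dq - db m) / (q x - b x 0 m) ^+ 2 =
   - dq * \sum_(m < n) (q x - b x 0 m) ^- 2 + \sum_m db m / (q x - b x 0 m) ^+ 2.
  rewrite mulr_sumr -big_split/=; apply: eq_bigr => m _.
  by rewrite opprB mulrBl mulNr addrC.
rewrite /dcrit; move: (\sum_(m < n) _) (\sum_(m < n) _) => S T /=; by field.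
Qed.

End LogarithmicDerivatives.

Section DiagonalAlgebra.
Variables (R : realType) (n : nat).

(** The defects of the equations of the system (for log s and for the b_m) are the
    unknowns of a Cauchy system whose right sides are the defects of the diagonal
    equations.  Here ax, ay, bx, by' stand for the x and y derivatives of log s
    and of the b_m. *)
Lemma diagonal_algebra (b : 'rV[R]_n) (q : 'I_n.+1 -> R) (s ax ay : R)
    (bx by' : 'I_n -> R) :
  0 < s -> injective (fun m => b 0 m) -> injective q ->
  (forall k, critical_root b (q k)) ->
  (s * ay = \sum_m bx m + (\sum_m b 0 m) * ax /\
   forall m, s * by' m = b 0 m * bx m + (1 + b 0 m ^+ 2) * ax) <->
  (forall k, ay + \sum_m by' m / (q k - b 0 m) =
             s^-1 * q k * (ax + \sum_m bx m / (q k - b 0 m))).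
Proof.
move=> s0 bi qi qc; have sn := lt0r_neq0 s0.
pose c0 := s * ay - (\sum_m bx m + (\sum_m b 0 m) * ax).
pose c m := s * by' m - (b 0 m * bx m + (1 + b 0 m ^+ 2) * ax).
have E k : c0 + \sum_m c m / (q k - b 0 m) =
    s * (ay + \sum_m by' m / (q k - b 0 m)) - q k * (ax + \sum_m bx m / (q k - b 0 m)).
  transitivity (s * (ay + \sum_m by' m / (q k - b 0 m))
      + (0 - q k) * (ax + \sum_m bx m / (q k - b 0 m))); last by rewrite sub0r mulNr.
  rewrite -(crit_shift bx 0 ax (qc k)) /c0.
  have -> : \sum_m c m / (q k - b 0 m) = s * (\sum_m by' m / (q k - b 0 m))
      + \sum_m ((0 - b 0 m) * bx m - (1 + b 0 m ^+ 2) * ax) / (q k - b 0 m).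
    rewrite mulr_sumr -big_split/=; apply: eq_bigr => m _.
    by rewrite mulrA -mulrDl; congr (_ / _); rewrite /c; ring.
  move: (\sum_m by' m / (q k - b 0 m))
    (\sum_m ((0 - b 0 m) * bx m - (1 + b 0 m ^+ 2) * ax) / (q k - b 0 m)).
  by move: (\sum_m bx m) (\sum_m b 0 m) => *; ring.
split=> [[H0 H] k|H].
  have : c0 + \sum_m c m / (q k - b 0 m) = 0.
    rewrite /c0 H0 subrr add0r big1// => m _; by rewrite /c H subrr mul0r.
  rewrite E => /eqP; rewrite subr_eq0 => /eqP e.
  by rewrite -mulrA -e mulKf.
have [k|H0 Hm] := @cauchy_system R n (fun m => b 0 m) c c0 q bi qi (fun k => (qc k).1).
  by rewrite E H -!mulrA mulVKf// subrr.
by split=> [|m]; apply/eqP; rewrite -subr_eq0; apply/eqP; [exact: H0|exact: Hm].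
Qed.

End DiagonalAlgebra.

(** * Smooth branches of critical points *)

Section JacobianKernel.
Variable R : realType.

(** Invertibility of the Jacobian, in the form in which it is checked: the
    components of f have no common direction of vanishing derivative. *)
Lemma jac_unitmx n (U : set 'rV[R]_n) (f : 'rV[R]_n -> 'rV[R]_n) (x : 'rV[R]_n) :
  smooth_map U f -> U x ->
  (forall v : 'rV[R]_n, (forall j, 'D_v (fun y => f y 0 j) x = 0) -> v = 0) ->
  jac f x \in unitmx.
Proof.
move=> fC Ux inj; rewrite -row_free_unit; apply: inj_row_free => v vJ.
apply: inj => j; have [/(_ x Ux) fd _] := fC j 1%N.
move/rowP/(_ j): vJ; rewrite [LHS]mxE [RHS]mxE; apply: etrans.
by rewrite derive_rowE//; apply: eq_bigr => i _; rewrite mxE.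
Qed.

End JacobianKernel.

Section RootBranches.
Variables (R : realType) (n : nat).

(** The point with coordinates (q, b); the slot of a also serves for an unknown
    root q. *)
Definition prepend (q : R) (b : 'rV[R]_n) : 'rV[R]_n.+1 :=
  \row_j oapp (fun m => b 0 m) q (unlift ord0 j).

Lemma acoord_prepend q b : acoord (prepend q b) = q.
Proof. by rewrite /acoord mxE unlift_none. Qed.

Lemma bcoord_prepend q b : bcoord (prepend q b) = b.
Proof. by apply/rowP => m; rewrite !mxE liftK. Qed.

Lemma class_C_acoord k U : class_C k U (@acoord R n).
Proof. exact: class_C_coord. Qed.

Lemma class_C_bcoord k U m : open U -> class_C k U (fun u : 'rV[R]_n.+1 => bcoord u 0 m).
Proof.
move=> oU; apply: class_C_near (class_C_coord k U (lift ord0 m)) => // u _.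
by rewrite mxE.
Qed.

Lemma acoord_continuous : continuous (@acoord R n).
Proof. exact: coord_continuous. Qed.

Lemma is_derive_acoord p (w : 'rV[R]_p -> 'rV[R]_n.+1) (z : 'rV[R]_p) i :
  differentiable w z ->
  is_derive z (delta_mx 0 i : 'rV[R]_p) (fun z' => acoord (w z'))
    (partial i (fun z' => acoord (w z')) z).
Proof.
move=> dw; apply/derivableP/diff_derivable.
have := @differentiable_comp _ _ _ _ w (@acoord R n) z dw.
by apply; exact: differentiable_coord.
Qed.

Lemma is_derive_bcoord p (w : 'rV[R]_p -> 'rV[R]_n.+1) (z : 'rV[R]_p) i m :
  differentiable w z ->
  is_derive z (delta_mx 0 i : 'rV[R]_p) (fun z' => bcoord (w z') 0 m)
    (partial i (fun z' => bcoord (w z') 0 m) z).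
Proof.
move=> dw; apply/derivableP/diff_derivable.
have := @differentiable_comp _ _ _ _ w (fun u : 'rV[R]_n.+1 => bcoord u 0 m) z dw.
by apply; have [C _] := @class_C_bcoord 1 setT m openT; exact: C.
Qed.

Lemma bcoord_continuous : continuous (@bcoord R n).
Proof.
move=> u; apply: continuous_rV => m; have [C _] := @class_C_bcoord 1 setT m openT.
exact: differentiable_continuous (C u I).
Qed.

Lemma prepend_continuous (T : topologicalType) (q : T -> R) (b : T -> 'rV[R]_n) x :
  {for x, continuous q} -> {for x, continuous b} ->
  {for x, continuous (fun y => prepend (q y) (b y))}.
Proof.
move=> qc bc; apply: continuous_rV => j.
case: (unliftP ord0 j) => [m|] jE.
  have -> : (fun y => prepend (q y) (b y) 0 j) = (fun y => b y 0 m).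
    by apply/funext => y; rewrite mxE jE liftK.
  have := @continuous_comp _ _ _ b (fun M : 'rV[R]_n => M 0 m) x bc.
  by apply; exact: coord_continuous.
have -> // : (fun y => prepend (q y) (b y) 0 j) = q.
by apply/funext => y; rewrite mxE jE unlift_none.
Qed.

Definition off_poles : set 'rV[R]_n.+1 := [set v | forall m, acoord v != bcoord v 0 m].

(** The defect of the critical equation at (q, b), followed by b itself: the critical
    points over b are the solutions of crit_map v = (0, b). *)
Definition crit_map (v : 'rV[R]_n.+1) : 'rV[R]_n.+1 :=
  prepend (n.+1%:R * (acoord v / (1 + acoord v ^+ 2))
           - \sum_(m < n) (acoord v - bcoord v 0 m)^-1) (bcoord v).

Lemma open_off_poles : open off_poles.
Proof.
apply: open_near => v vP; apply: near_forall => m.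
have c : {for v, continuous (fun v : 'rV[R]_n.+1 => acoord v - bcoord v 0 m)}.
  apply: (@class_CB R _ 0 setT) => //; first exact: openT.
    exact: class_C_acoord.
  exact: class_C_bcoord openT.
have := continuous_near_neq0 c; rewrite subr_eq0 => /(_ (vP m)).
by apply: filterS => w; rewrite subr_eq0.
Qed.

Lemma crit_mapP v : off_poles v ->
  crit_map v = prepend 0 (bcoord v) <-> critical_root (bcoord v) (acoord v).
Proof.
move=> vP; split=> [/(congr1 (@acoord R n))|[_ E]].
  by rewrite !acoord_prepend => /eqP; rewrite subr_eq0 => /eqP.
by rewrite /crit_map E subrr.
Qed.

Lemma bcoord_crit_map v : bcoord (crit_map v) = bcoord v.
Proof. exact: bcoord_prepend. Qed.

Lemma smooth_crit_map : smooth_map off_poles crit_map.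
Proof.
move=> j k; have oO := open_off_poles.
case: (unliftP ord0 j) => [m|] jE.
  apply: class_C_near (class_C_bcoord k m oO) => // v _.
  by rewrite [RHS]mxE jE liftK.
apply: (@class_C_near _ _ _ _ (fun v : 'rV[R]_n.+1 =>
  n.+1%:R * (acoord v * (1 + acoord v ^+ 2)^-1) - \sum_(m < n) (acoord v - bcoord v 0 m)^-1)) => //.
  by move=> v _; rewrite [RHS]mxE jE unlift_none.
have aC := @class_C_acoord k off_poles.
apply: class_CB => //.
  apply: class_CM => //; first exact: class_C_cst.
  apply: class_CM => //; apply: class_CV => //; first by move=> v _; exact: sqr1_neq0.
  by apply: class_CD => //; [exact: class_C_cst|exact: class_CX].
apply: class_C_sum => // m; apply: class_CV => //.
  by move=> v /(_ m); rewrite subr_eq0.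
by apply: class_CB => //; exact: class_C_bcoord.
Qed.

(** The Jacobian of the critical map is triangular with [dcrit] and 1 on the diagonal. *)
Lemma jac_crit_map v : off_poles v -> dcrit (bcoord v) (acoord v) != 0 ->
  jac crit_map v \in unitmx.
Proof.
move=> vP d0; apply: (jac_unitmx smooth_crit_map vP) => w w0.
have wb m : w 0 (lift ord0 m) = 0.
  rewrite -[RHS](w0 (lift ord0 m)); have [_ <-] := is_derive_coord v w (lift ord0 m).
  by congr ('D_w _ v); apply/funext => y; rewrite !mxE liftK /= mxE.
have ha : is_derive v w (@acoord R n) (w 0 ord0) := is_derive_coord v w ord0.
have hb m : is_derive v w (fun v : 'rV[R]_n.+1 => bcoord v 0 m) 0.
  rewrite -(wb m); have := is_derive_coord v w (lift ord0 m); congr is_derive.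
  by apply/funext => y; rewrite mxE.
have E : is_derive v w (fun v => crit_map v 0 ord0)
    (dcrit (bcoord v) (acoord v) * w 0 ord0).
  have := is_derive_critical (q := @acoord R n) (b := @bcoord R n) vP ha hb.
  rewrite big1 ?subr0 => [H|m _]; last by rewrite mul0r.
  by congr is_derive: H; apply/funext => y; rewrite [RHS]mxE unlift_none.
apply/rowP => j; rewrite mxE; case: (unliftP ord0 j) => [m ->|->]; first exact: wb.
have := w0 ord0; rewrite (@derive_val _ _ _ _ _ _ _ E) => /eqP.
by rewrite mulf_eq0 (negPf d0) => /eqP.
Qed.

End RootBranches.

Section RootBranchesExist.
Variables (R : realType) (n : nat).
Hypothesis n_gt0 : (0 < n)%N.

Lemma near_injective p (I : finType) (f : I -> 'rV[R]_p -> R) (x : 'rV[R]_p) :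
  (forall i, {for x, continuous (f i)}) -> injective (f^~ x) ->
  \forall y \near x, injective (f^~ y).
Proof.
move=> fc fi.
have H : \forall y \near x, forall ij : I * I, ij.1 != ij.2 -> f ij.1 y != f ij.2 y.
  apply: near_forall => -[i j] /=.
  have [->|ij] := eqVneq i j; first by apply: filterE.
  have c : {for x, continuous (fun y => f i y - f j y)}.
    by apply: continuousB; exact: fc.
  have := continuous_near_neq0 c; rewrite subr_eq0 (contra_neq (@fi i j))// => /(_ isT).
  by apply: filterS => y; rewrite subr_eq0.
apply: filterS H => y H i j /= e; apply/eqP/negPn/negP => ij.
by have := H (i, j) ij; rewrite /= e eqxx.
Qed.

Lemma bcoord_coord_continuous (u : 'rV[R]_n.+1) m :
  {for u, continuous (fun v : 'rV[R]_n.+1 => bcoord v 0 m)}.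
Proof. exact: (@class_C_bcoord R n 0 setT m openT u I). Qed.

Lemma critical_chart (b : 'rV[R]_n) (q : 'I_n.+1 -> R) i :
  injective (fun m => b 0 m) -> injective q -> (forall k, critical_root b (q k)) ->
  exists U V Psi, [/\ U (prepend (q i) b), U `<=` @off_poles R n &
    coordinates U V (@crit_map R n) Psi].
Proof.
move=> bi qi qc.
have vP : off_poles (prepend (q i) b).
  by move=> m; rewrite acoord_prepend bcoord_prepend; case: (qc i).
apply: (inverse_function (@open_off_poles R n) (@smooth_crit_map R n) vP).
apply: jac_crit_map => //; rewrite acoord_prepend bcoord_prepend.
exact: dcrit_neq0.
Qed.

Lemma critical_prepend (b : 'rV[R]_n) q :
  critical_root b q -> crit_map (prepend q b) = prepend 0 b.
Proof.
move=> [qb E]; have vP : off_poles (prepend q b).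
  by move=> m; rewrite acoord_prepend bcoord_prepend.
by have := crit_mapP vP; rewrite acoord_prepend bcoord_prepend => ->.
Qed.

Lemma prepend0_continuous (u : 'rV[R]_n.+1) :
  {for u, continuous (fun u : 'rV[R]_n.+1 => prepend 0 (bcoord u))}.
Proof.
apply: prepend_continuous; [exact: cst_continuous|exact: bcoord_continuous].
Qed.

Lemma critical_of_chart U V Psi (b : 'rV[R]_n) :
  U `<=` @off_poles R n -> coordinates U V (@crit_map R n) Psi ->
  V (prepend 0 b) -> critical_root b (acoord (Psi (prepend 0 b))).
Proof.
move=> UP [_ _ [_ VU] _ fK] Vb; set v := Psi _.
have vE : crit_map v = prepend 0 b by exact: fK.
have bv : bcoord v = b by rewrite -bcoord_crit_map vE bcoord_prepend.
rewrite -{1}bv; apply/crit_mapP; last by rewrite vE bv.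
exact/UP/VU.
Qed.

Lemma chart_continuous U V Psi (b : 'rV[R]_n) :
  coordinates U V (@crit_map R n) Psi -> V (prepend 0 b) ->
  {for b, continuous (fun b => acoord (Psi (prepend 0 b)))}.
Proof.
move=> [[oU oV] [_ PC] _ _ _] Vb.
have c1 : {for b, continuous (fun b : 'rV[R]_n => prepend 0 b)}.
  by apply: prepend_continuous; [exact: cst_continuous|exact: cvg_id].
have c2 := differentiable_continuous (smooth_rV_differentiable PC Vb).
have c3 := @continuous_comp _ _ _ (fun b => prepend 0 b) Psi b c1 c2.
have := @continuous_comp _ _ _ (fun b => Psi (prepend 0 b)) (@acoord R n) b c3.
by apply; exact: acoord_continuous.
Qed.

(** Local inverses of the critical map at the N points (q_k, b) provide N branches
    over a neighbourhood; they remain distinct by continuity. *)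
Lemma regular_root_branches (u0 : 'rV[R]_n.+1) : regular_domain u0 ->
  exists D q, [/\ open D, D u0, D `<=` @regular_domain R n & root_branches D q].
Proof.
move=> [a0 bi [q0 [qi qc]]].
have /choice[Psi] : forall k, exists Psi, exists UV : set 'rV[R]_n.+1 * set 'rV[R]_n.+1,
    [/\ UV.1 (prepend (q0 k) (bcoord u0)), UV.1 `<=` @off_poles R n &
        coordinates UV.1 UV.2 (@crit_map R n) Psi].
  move=> k; have [U [V [Psi H]]] := critical_chart k bi qi qc.
  by exists Psi, (U, V).
move=> /choice[UV H].
pose q k b := acoord (Psi k (prepend 0 b)).
have V0 k : (UV k).2 (prepend 0 (bcoord u0)).
  have [U0 _ [_ _ [UV_ _] _ _]] := H k.
  by rewrite -(critical_prepend (qc k)); exact: UV_.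
have q0E k : q k (bcoord u0) = q0 k.
  have [U0 _ [_ _ _ K _]] := H k.
  by rewrite /q -(critical_prepend (qc k)) K// acoord_prepend.
have qcont k u : (UV k).2 (prepend 0 (bcoord u)) -> {for bcoord u, continuous (q k)}.
  by move=> Vu; have [_ _ C] := H k; exact: chart_continuous C Vu.
have qcont0 k : {for u0, continuous (fun u => q k (bcoord u))}.
  have := @continuous_comp _ _ _ (@bcoord R n) (q k) u0 (@bcoord_continuous R n u0).
  by apply; exact: qcont.
have N1 : \forall u \near u0, forall k, (UV k).2 (prepend 0 (bcoord u)).
  apply: near_forall => k; have [_ _ [[_ oV] _ _ _ _]] := H k.
  exact: (prepend0_continuous (open_nbhs_nbhs (conj oV (V0 k)))).
have N2 : \forall u \near u0, injective (fun k => q k (bcoord u)).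
  by apply: (near_injective qcont0) => k l; rewrite !q0E => /qi.
have N3 : \forall u \near u0, injective (fun m => bcoord u 0 m).
  by apply: near_injective bi => m; exact: bcoord_coord_continuous.
have N4 : \forall u \near u0, 0 < acoord u.
  exact: (@cvgr_gt R _ (nbhs u0) _ (@acoord R n) _ (@acoord_continuous R n u0) 0 a0).
have [D [oD D0 DP]] : exists D : set 'rV[R]_n.+1, [/\ open D, D u0 & D `<=`
    [set u | [/\ forall k, (UV k).2 (prepend 0 (bcoord u)),
      injective (fun k => q k (bcoord u)), injective (fun m => bcoord u 0 m) &
      0 < acoord u]]].
  by apply: near_open; apply: filterS2 (filterI N1 N2) (filterI N3 N4) => u [? ?] [? ?].
have crit u k : D u -> critical_root (bcoord u) (q k (bcoord u)).
  move=> /DP[Vu _ _ _]; have [_ UP C] := H k.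
  exact: critical_of_chart UP C (Vu k).
exists D, q; split=> // u Du; have [Vu qu bu au] := DP u Du.
  by split=> //; exists (fun k => q k (bcoord u)); split=> // k; exact: crit.
by split=> // k; [exact: crit|exact: qcont].
Qed.

(** By continuity (q_k(b), b) stays in the chart of the critical map at the base
    point, so q_k(b) is the first coordinate of the smooth inverse at (0, b). *)
Lemma root_branches_smooth (D : set 'rV[R]_n.+1) q (u0 : 'rV[R]_n.+1) :
  open D -> D `<=` @regular_domain R n -> root_branches D q -> D u0 ->
  exists W, [/\ open W, W u0, W `<=` D & forall k, smooth W (fun u => q k (bcoord u))].
Proof.
move=> oD DR qD Du0; have [a0 bi _] := DR _ Du0; have [qi qc qcont] := qD _ Du0.
have /choice[UVP H] : forall k, exists UVP : set 'rV[R]_n.+1 * set 'rV[R]_n.+1 * _,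
    [/\ UVP.1.1 (prepend (q k (bcoord u0)) (bcoord u0)), UVP.1.1 `<=` @off_poles R n &
        coordinates UVP.1.1 UVP.1.2 (@crit_map R n) UVP.2].
  move=> k; have [U [V [Psi H]]] := critical_chart k bi qi qc.
  by exists (U, V, Psi).
have N1 : \forall u \near u0, forall k, (UVP k).1.1 (prepend (q k (bcoord u)) (bcoord u)).
  apply: near_forall => k; have [U0 _ [[oU _] _ _ _ _]] := H k.
  have c1 := @continuous_comp _ _ _ (@bcoord R n) (q k) u0 (@bcoord_continuous R n u0) (qcont k).
  have := prepend_continuous c1 (@bcoord_continuous R n u0).
  by move=> /(_ _ (open_nbhs_nbhs (conj oU U0))).
have N2 : \forall u \near u0, D u := open_nbhs_nbhs (conj oD Du0).
have [W [oW W0 WP]] := near_open (filterI N1 N2).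
exists W; split=> //; first by move=> u /WP[].
move=> k j; have [_ _ [[_ oV] [_ PC] [UV_ _] K _]] := H k.
have E u : W u -> crit_map (prepend (q k (bcoord u)) (bcoord u)) = prepend 0 (bcoord u).
  by move=> /WP[_ Du]; apply: critical_prepend; case: (qD u Du).
apply: (@class_C_near _ _ _ _ (fun u => (UVP k).2 (prepend 0 (bcoord u)) 0 ord0)) => //.
  move=> u Wu; have [Uu _] := WP u Wu.
  by rewrite -(E u Wu) K; [rewrite -/(acoord _) acoord_prepend|exact: Uu].
apply: (@class_C_comp R n.+1 n.+1 j W (UVP k).1.2
  (fun u => prepend 0 (bcoord u)) (fun v => (UVP k).2 v 0 ord0)) => //.
- by move=> u Wu; rewrite -(E u Wu); apply: UV_; have [] := WP u Wu.
- move=> i; case: (unliftP ord0 i) => [m|] iE.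
    apply: class_C_near (class_C_bcoord j m oW) => // u _.
    by rewrite [RHS]mxE iE liftK.
  apply: class_C_near (class_C_cst j W 0) => // u _.
  by rewrite mxE iE unlift_none.
- exact: PC.
Qed.

End RootBranchesExist.

(** * Riemann invariants *)

Section RiemannInvariants.
Variables (R : realType) (n : nat).
Hypothesis n_gt0 : (0 < n)%N.

Lemma class_C_sqrt p k (U : set 'rV[R]_p) (g : 'rV[R]_p -> R) : open U ->
  (forall x, U x -> 0 < g x) -> class_C k U g ->
  class_C k U (fun x => Num.sqrt (g x)).
Proof.
move=> oU g0 gC; apply: class_C_near (class_C_powR 2^-1 oU g0 gC) => // x /g0 gx.
by rewrite powR12_sqrt// ltW.
Qed.

Lemma class_C_inv_sqrt_a k (W : set 'rV[R]_n.+1) : open W ->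
  (forall u, W u -> 0 < acoord u) ->
  class_C k W (fun u => (Num.sqrt (acoord u))^-1).
Proof.
move=> oW a0; apply: class_CV => //.
  by move=> u /a0 au; rewrite gt_eqF// sqrtr_gt0.
by apply: class_C_sqrt => //; exact: class_C_acoord.
Qed.

Section Branches.
Variables (q : 'I_n.+1 -> 'rV[R]_n -> R) (W : set 'rV[R]_n.+1).
Hypotheses (oW : open W) (Wreg : W `<=` @regular_domain R n) (qW : root_branches W q)
  (qC : forall k, smooth W (fun u => q k (bcoord u))).

Lemma smooth_riemann_r k : smooth W (riemann_r q k).
Proof.
move=> j; apply: class_CM => //.
  apply: class_CM => //.
    by apply: class_C_inv_sqrt_a => // u /Wreg[].
  apply: class_C_powR => //; first by move=> u _; rewrite ltr_pwDl// sqr_ge0.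
  by apply: class_CD => //; [exact: class_C_cst|apply: class_CX => //; exact: qC].
apply: class_C_prod => // m; apply: class_CB => //; first exact: qC.
exact: class_C_bcoord.
Qed.

Lemma smooth_velocity k : smooth W (velocity q k).
Proof.
move=> j; apply: class_CM => //; last exact: qC.
by apply: class_C_inv_sqrt_a => // u /Wreg[].
Qed.

Lemma riemann_r_neq0 k u : W u -> riemann_r q k u != 0.
Proof.
move=> Wu; have [au _ _] := Wreg Wu; have [_ /(_ k) [qb _] _] := qW Wu.
apply: mulf_neq0; last by apply/prodf_neq0 => m _; rewrite subr_eq0.
apply: mulf_neq0; first by rewrite invr_neq0// gt_eqF// sqrtr_gt0.
by rewrite gt_eqF// powR_gt0// ltr_pwDl// sqr_ge0.
Qed.

(** The factor da / (2 a) is the derivative of log s. *)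
Lemma is_derive_riemann_r p (w : 'rV[R]_p -> 'rV[R]_n.+1) (x v : 'rV[R]_p) k
    (da : R) (db : 'I_n -> R) :
  differentiable w x -> W (w x) ->
  is_derive x v (fun y => acoord (w y)) da ->
  (forall m, is_derive x v (fun y => bcoord (w y) 0 m) (db m)) ->
  is_derive x v (fun y => riemann_r q k (w y))
    (- riemann_r q k (w x) * (da / (2 * acoord (w x))
       + \sum_m db m / (q k (bcoord (w x)) - bcoord (w x) 0 m))).
Proof.
move=> dw Wx ha hb; have [au _ _] := Wreg Wx; have [_ /(_ k) qc _] := qW Wx.
have s0 : 0 < Num.sqrt (acoord (w x)) by rewrite sqrtr_gt0.
have [/(_ _ Wx) dQ _] := qC k 1%N.
have dq : differentiable (fun y => q k (bcoord (w y))) x.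
  exact: (@differentiable_comp _ _ _ _ w (fun u => q k (bcoord u)) x dw dQ).
have hq := derivableP (@diff_derivable _ _ _ _ x v dq).
have := is_derive_critical_value (s := fun y => Num.sqrt (acoord (w y)))
  (q := fun y => q k (bcoord (w y))) (b := fun y => bcoord (w y)) s0 qc
  (is_derive_sqrt (f := fun y => acoord (w y)) au ha) hq hb.
move=> H; apply: is_derive_eq H _; congr (_ * (_ + _)).
rewrite -{3}[acoord (w x)]sqr_sqrtr ?ltW//.
by have := lt0r_neq0 s0 => h; field.
Qed.

(** In a direction that kills every dr^k, the derivatives of log s and of the b_m
    solve a homogeneous Cauchy system. *)
Lemma jac_riemann_r u : W u -> jac (fun u => \row_i riemann_r q i u) u \in unitmx.
Proof.
move=> Wu; have [au bi _] := Wreg Wu; have [qi qc _] := qW Wu.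
have sm : smooth_map W (fun u => \row_i riemann_r q i u).
  by move=> k j; apply: class_C_near (smooth_riemann_r k j) => // x _; rewrite mxE.
apply: (jac_unitmx sm Wu) => v vr.
have hb m : is_derive u v (fun u : 'rV[R]_n.+1 => bcoord u 0 m) (v 0 (lift ord0 m)).
  have := is_derive_coord u v (lift ord0 m); congr is_derive.
  by apply/funext => y; rewrite mxE.
have did : differentiable (fun u : 'rV[R]_n.+1 => u) u by exact: ex_diff.
have := @cauchy_system R n (fun m => bcoord u 0 m) (fun m => v 0 (lift ord0 m))
  (v 0 ord0 / (2 * acoord u)) _ bi qi (fun k => (qc k).1).
case=> [k|v0 vm].
  have H := is_derive_riemann_r k did Wu (is_derive_coord u v ord0) hb.
  have := vr k.
  have -> : (fun y => (\row_i riemann_r q i y) 0 k) = riemann_r q k.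
    by apply/funext => y; rewrite mxE.
  rewrite (@derive_val _ _ _ _ _ _ _ H) => /eqP.
  by rewrite mulf_eq0 oppr_eq0 (negPf (riemann_r_neq0 k Wu)) => /eqP.
apply/rowP => j; rewrite mxE; case: (unliftP ord0 j) => [m ->|->]; first exact: vm.
move/eqP: v0; rewrite mulf_eq0 invr_eq0 mulf_eq0 pnatr_eq0/= (gt_eqF au) orbF.
by move/eqP.
Qed.

End Branches.

(** The first equation becomes one for log s, whose derivatives are the da; after
    multiplication by s the right sides are polynomial in b and the derivatives. *)
Lemma ab_systemE (w : 'rV[R]_2 -> 'rV[R]_n.+1) (z : 'rV[R]_2) :
  differentiable w z -> 0 < acoord (w z) ->
  let s := Num.sqrt (acoord (w z)) in
  let da i := partial i (fun z' => acoord (w z')) z / (2 * acoord (w z)) in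
  let db i m := partial i (fun z' => bcoord (w z') 0 m) z in
  @ab_system R n w z <->
  (s * da 1 = \sum_m db 0 m + (\sum_m bcoord (w z) 0 m) * da 0 /\
   forall m, s * db 1 m = bcoord (w z) 0 m * db 0 m
             + (1 + bcoord (w z) 0 m ^+ 2) * da 0).
Proof.
move=> dw a0 s da db.
have s0 : s != 0 by rewrite gt_eqF// sqrtr_gt0.
have ha i := is_derive_acoord i dw.
have hb i m : is_derive z (delta_mx 0 i : 'rV[R]_2) (fun z' => bcoord (w z') 0 m) (db i m).
  exact: is_derive_bcoord.
have [_ hsum] := is_derive_bigsum (fun m => hb 0 m).
have [_ hinv] := is_derive_inv (f := fun z' => Num.sqrt (acoord (w z'))) s0
  (is_derive_sqrt (f := fun z' => acoord (w z')) a0 (ha 0)).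
have aE : acoord (w z) = s ^+ 2 by rewrite sqr_sqrtr// ltW.
rewrite /ab_system /d_x /d_y -/s.
rewrite [partial 0 (fun z' => \sum_(m < n) _) z]hsum.
rewrite [partial 0 (fun z' => (Num.sqrt _)^-1) z]hinv -/s.
rewrite /da aE {ha hb hsum hinv da aE}; rewrite /db {db}.
move: s0; move: s => s s0.
move: (partial 1 (fun z' => acoord (w z')) z) (partial 0 (fun z' => acoord (w z')) z).
move=> A1 A0; split=> -[H0 Hm]; split=> [|m].
- by rewrite H0; move: (\sum_m _) (\sum_m _) => S B; field.
- by rewrite Hm; field.
- rewrite (_ : A1 = 2 * s * (s * (A1 / (2 * s ^+ 2)))); last by field.
  by rewrite H0; move: (\sum_m _) (\sum_m _) => S B; field.
- set B1 := partial 1 _ z; rewrite (_ : B1 = s^-1 * (s * B1)); last by rewrite mulKf.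
  by have := Hm m; rewrite -/B1 => ->; field.
Qed.

(* The functions r^k are Riemann invariants. *)
Lemma riemann_coordinates (D : set 'rV[R]_n.+1) q u0 :
  open D -> D `<=` @regular_domain R n -> root_branches D q -> D u0 ->
  exists U V Phi, [/\ U u0, U `<=` D,
    (forall k, smooth U (fun u => q k (bcoord u))) &
    coordinates U V (fun u => \row_i riemann_r q i u) Phi].
Proof.
move=> oD DR qD Du0; have [W [oW Wu0 WD qC]] := root_branches_smooth n_gt0 oD DR qD Du0.
have WR : W `<=` @regular_domain R n by move=> u /WD/DR.
have qW : root_branches W q by move=> u /WD/qD.
have sm : smooth_map W (fun u => \row_i riemann_r q i u).
  move=> k j; apply: class_C_near (smooth_riemann_r oW WR qC k j) => // x _.
  by rewrite mxE.
have [U [V [Phi [Uu UW C]]]] := inverse_function oW sm Wu0 (jac_riemann_r oW WR qW qC Wu0).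
exists U, V, Phi; split=> //; first by move=> u /UW/WD.
by move=> k j; apply: class_CS (qC k j).
Qed.

Lemma diagonal_riemann (D : set 'rV[R]_n.+1) q U V Phi :
  D `<=` @regular_domain R n -> root_branches D q -> U `<=` D ->
  (forall k, smooth U (fun u => q k (bcoord u))) ->
  coordinates U V (fun u => \row_i riemann_r q i u) Phi ->
  diagonal_form (@ab_system R n) U V (fun u => \row_i riemann_r q i u) Phi
    (fun i s => velocity q i (Phi s)).
Proof.
move=> DR qD UD qC C; have [[oU oV] [_ PC] [UV VU] PK KP] := C.
have UR : U `<=` @regular_domain R n by move=> u /UD/DR.
have qU : root_branches U q by move=> u /UD/qD.
split=> // [i j|Omega w oO wC wU z Oz].
  apply: (@class_C_comp R n.+1 n.+1 j V U Phi (velocity q i)) => //.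
  - by move=> k; exact: PC.
  - exact: (smooth_velocity oU UR qC).
have dw := smooth_rV_differentiable wC Oz; have Uz := wU z Oz.
have [au bi _] := UR _ Uz; have [qi qc _] := qU _ Uz.
rewrite (ab_systemE dw au) (diagonal_algebra _ _ _ _ _ bi qi qc) ?sqrtr_gt0// PK//.
have D1 (i : 'I_2) k : partial i (fun z' => (\row_i riemann_r q i (w z')) 0 k) z =
   - riemann_r q k (w z) * (partial i (fun z' => acoord (w z')) z / (2 * acoord (w z))
     + \sum_m partial i (fun z' => bcoord (w z') 0 m) z /
         (q k (bcoord (w z)) - bcoord (w z) 0 m)).
  have ha := is_derive_acoord i dw.
  have hb m := is_derive_bcoord i m dw.
  have [_ <-] := is_derive_riemann_r UR qU qC k dw Uz ha hb.
  by rewrite /partial; congr ('D_(delta_mx 0 i) _ z); apply/funext => y; rewrite mxE.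
split=> H k; have rn := riemann_r_neq0 UR qU k Uz.
  rewrite /d_y /d_x !D1 H /velocity.
  by rewrite !mulNr mulrN; congr (- _); rewrite mulrCA.
have := H k; rewrite /d_y /d_x !D1 /velocity !mulNr mulrN => /oppr_inj.
by rewrite [RHS]mulrCA => /(mulfI rn).
Qed.

End RiemannInvariants.

(** * The semi-Hamiltonian property *)

Section GibbonsTsarevAlgebra.
Variable R : realType.

(** The hypothesis is the symmetry of the second derivatives of one b along r^j and
    r^k, with X the common value of the derivatives of A_j along r^k and of A_k
    along r^j.  It is linear in X, and its solution does not depend on b. *)
Lemma gt_algebra (X Aj Ak qj qk b : R) :
  qj != qk -> qj != b -> qk != b ->
  let bj := Aj * (1 + b ^+ 2) / (qj - b) in
  let bk := Ak * (1 + b ^+ 2) / (qk - b) in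
  let qjk := Ak * (1 + qj ^+ 2) / (qk - qj) in
  let qkj := Aj * (1 + qk ^+ 2) / (qj - qk) in
  X * (1 + b ^+ 2) / (qj - b)
    + Aj * (2 * b * bk / (qj - b) - (1 + b ^+ 2) * (qjk - bk) / (qj - b) ^+ 2) =
  X * (1 + b ^+ 2) / (qk - b)
    + Ak * (2 * b * bj / (qk - b) - (1 + b ^+ 2) * (qkj - bj) / (qk - b) ^+ 2) ->
  X = 2 * (1 + qj * qk) / (qj - qk) ^+ 2 * (Aj * Ak).
Proof.
rewrite -subr_eq0 => h1; rewrite -subr_eq0 => h2; rewrite -subr_eq0 => h3.
have h4 := sqr1_neq0 b.
have h5 : qk - qj != 0 by rewrite -opprB oppr_eq0.
move=> bj bk qjk qkj /eqP; rewrite -subr_eq0 => /eqP E.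
pose c := (1 + b ^+ 2) * (qk - qj) / ((qj - b) * (qk - b)).
have c0 : c != 0 by rewrite /c !mulf_neq0// invr_neq0// mulf_neq0.
apply/eqP; rewrite -subr_eq0; apply/eqP/(mulfI c0); rewrite mulr0 -[RHS]E.
rewrite /c /bj /bk /qjk /qkj; field.
by rewrite ?h1 ?h2 ?h3 ?h5.
Qed.

(** G is the derivative of A_j (1 + 2 q_i^2 - q_i q_j) / (q_j - q_i)^2 when A_j, q_i, q_j
    have derivatives X, dqi, dqj; the given expression is the quotient
    (d mu_i / dr^j) / (mu_j - mu_i). *)
Lemma sh_algebra (Aj Ak qi qj qk : R) :
  qi != qj -> qj != qk -> qi != qk ->
  let X := 2 * (1 + qj * qk) / (qj - qk) ^+ 2 * (Aj * Ak) in
  let d A p q := A * (1 + p ^+ 2) / (q - p) in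
  let G X Aj dqi dqj qi qj :=
    X * (1 + 2 * qi ^+ 2 - qi * qj) / (qj - qi) ^+ 2
    + Aj * ((4 * qi * dqi - dqi * qj - qi * dqj) / (qj - qi) ^+ 2
            - 2 * (1 + 2 * qi ^+ 2 - qi * qj) * (dqj - dqi) / (qj - qi) ^+ 3) in
  G X Aj (d Ak qi qk) (d Ak qj qk) qi qj = G X Ak (d Aj qi qj) (d Aj qk qj) qi qk.
Proof.
rewrite -subr_eq0 => h1; rewrite -subr_eq0 => h2; rewrite -subr_eq0 => h3.
have h4 : qk - qj != 0 by rewrite -opprB oppr_eq0.
have h5 : qj - qi != 0 by rewrite -opprB oppr_eq0.
have h6 : qk - qi != 0 by rewrite -opprB oppr_eq0.
move=> X d G; rewrite /G /X /d; field.
by rewrite ?h1 ?h2 ?h3 ?h4 ?h5 ?h6.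
Qed.

End GibbonsTsarevAlgebra.

Section SemiHamiltonian.
Variables (R : realType) (n : nat).
Hypothesis n_gt0 : (0 < n)%N.
Variables (D U V : set 'rV[R]_n.+1) (q : 'I_n.+1 -> 'rV[R]_n -> R)
  (Phi : 'rV[R]_n.+1 -> 'rV[R]_n.+1).
Hypotheses (Dreg : D `<=` @regular_domain R n) (qD : root_branches D q) (UD : U `<=` D)
  (qC : forall k, smooth U (fun u => q k (bcoord u)))
  (C : coordinates U V (fun u => \row_i riemann_r q i u) Phi).

Let oU : open U. Proof. by case: C => -[]. Qed.
Let oV : open V. Proof. by case: C => -[]. Qed.
Let PhiC : smooth_map V Phi. Proof. by case: C => _ []. Qed.
Let VU t : V t -> U (Phi t). Proof. by case: C => _ _ [_ + _ _]; apply. Qed.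
Let rPhi t : V t -> \row_i riemann_r q i (Phi t) = t.
Proof. by case: C => _ _ _ _; apply. Qed.
Let Ureg : U `<=` @regular_domain R n. Proof. by move=> u /UD/Dreg. Qed.
Let qU : root_branches U q. Proof. by move=> u /UD/qD. Qed.

Let e (k : 'I_n.+1) : 'rV[R]_n.+1 := delta_mx 0 k.
Let a t := acoord (Phi t).
Let b t := bcoord (Phi t).
Let Q i t := q i (b t).
Let A j t := partial j a t / (2 * a t).

Let a_gt0 t : V t -> 0 < a t. Proof. by move=> /VU/Ureg[]. Qed.
Let b_inj t : V t -> injective (fun m => b t 0 m). Proof. by move=> /VU/Ureg[]. Qed.
Let Q_inj t : V t -> injective (fun k => Q k t). Proof. by move=> /VU/qU[]. Qed.
Let Q_crit t k : V t -> critical_root (b t) (Q k t).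
Proof. by move=> /VU/qU[_ qc _]; exact: qc. Qed.
Let Q_neq t i j : V t -> i != j -> Q i t != Q j t.
Proof. by move=> Vt; apply: contra_neq => /(Q_inj Vt). Qed.

Let smooth_a : smooth V a. Proof. exact: PhiC. Qed.
Let smooth_b m : smooth V (fun t => b t 0 m).
Proof.
by move=> k; apply: class_C_near (PhiC (lift ord0 m) k) => // t _; rewrite mxE.
Qed.
Let smooth_Q k : smooth V (Q k).
Proof.
move=> j; have := @class_C_comp R _ _ j V U Phi (fun u => q k (bcoord u)).
by apply; [exact: oV|exact: VU|move=> i; exact: PhiC|exact: qC].
Qed.
Let da t v : V t -> is_derive t v a ('D_v a t).
Proof. exact: smooth_is_derive. Qed.
Let db t v m : V t -> is_derive t v (fun t => b t 0 m) ('D_v (fun t => b t 0 m) t).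
Proof. exact: smooth_is_derive. Qed.
Let dQ t v k : V t -> is_derive t v (Q k) ('D_v (Q k) t).
Proof. exact: smooth_is_derive. Qed.

Lemma near_V t (P : 'rV[R]_n.+1 -> Prop) : V t -> (forall y, V y -> P y) ->
  \forall y \near t, P y.
Proof. by move=> Vt H; apply: filterS (open_nbhs_nbhs (conj oV Vt)) => y /H. Qed.

(** Along r^j the other r^i are constant, so A_j + \sum_m (d b_m) / (q_i - b_m) = 0 for
    i <> j.  By [crit_shift] with p = q_j, whose right side also vanishes for i = j,
    this becomes a full Cauchy system. *)
Lemma partial_b t j m : V t ->
  partial j (fun t => b t 0 m) t = A j t * (1 + b t 0 m ^+ 2) / (Q j t - b t 0 m).
Proof.
move=> Vt; have [Qb _] := Q_crit j Vt.
pose beta m := partial j (fun t => b t 0 m) t.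
have L i : i != j -> A j t + \sum_m beta m / (Q i t - b t 0 m) = 0.
  move=> ij; have dPhi := smooth_rV_differentiable PhiC Vt.
  have H1 := is_derive_riemann_r Ureg qU qC i dPhi (VU Vt) (da (e j) Vt)
    (fun m => db (e j) m Vt).
  have H2 : is_derive t (e j) (fun y => riemann_r q i (Phi y)) 0.
    have := is_derive_coord t (e j) i; rewrite mxE eqxx/= (negPf ij).
    apply: near_eq_is_derive; apply: near_V Vt _ => y Vy.
    by rewrite -{1}(rPhi Vy) mxE.
  have := is_derive_unique H1 H2 => /eqP; rewrite mulf_eq0 oppr_eq0.
  by rewrite (negPf (riemann_r_neq0 Ureg qU i (VU Vt))) => /eqP.
have [k|_ /(_ m)] := @cauchy_system R n (fun m => b t 0 m)
  (fun m => (Q j t - b t 0 m) * beta m - (1 + b t 0 m ^+ 2) * A j t)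
  ((Q j t - \sum_m b t 0 m) * A j t - \sum_m beta m) _ (b_inj Vt) (Q_inj Vt)
  (fun k => (Q_crit k Vt).1).
  rewrite (crit_shift beta (Q j t) (A j t) (Q_crit k Vt)).
  have [->|kj] := eqVneq k j; first by rewrite subrr mul0r.
  by rewrite L ?mulr0.
have nz : Q j t - b t 0 m != 0 by rewrite subr_eq0.
by rewrite -/(beta m) => E; apply: (mulfI nz); move/subr0_eq: E => ->; field.
Qed.

(** Differentiate the critical equation for q_i and divide by [dcrit]. *)
Lemma partial_Q t i j : V t -> i != j ->
  partial j (Q i) t = A j t * (1 + Q i t ^+ 2) / (Q j t - Q i t).
Proof.
move=> Vt ij; have [Qb _] := Q_crit i Vt.
have H1 := is_derive_critical (q := Q i) (b := b) Qb (dQ (e j) i Vt)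
  (fun m => db (e j) m Vt).
have H2 : is_derive t (e j) (fun y => n.+1%:R * (Q i y / (1 + Q i y ^+ 2))
    - \sum_m (Q i y - b y 0 m)^-1) 0.
  apply: near_eq_is_derive (is_derive_cst (0 : R) t (e j)).
  by apply: near_V Vt _ => y Vy; have [_ ->] := Q_crit i Vy; rewrite subrr.
have := is_derive_unique H1 H2; rewrite -/(partial j (Q i) t) => /subr0_eq E.
have d0 : dcrit (b t) (Q i t) != 0.
  apply: (dcrit_neq0 (q := fun k => Q k t) i n_gt0 (b_inj Vt) (Q_inj Vt)) => k.
  exact: Q_crit.
apply: (mulfI d0); rewrite E.
have ji : Q j t != Q i t by apply: Q_neq => //; rewrite eq_sym.
rewrite -mulrA mulrCA -(crit_motion ji (Q_crit j Vt) (Q_crit i Vt)) mulr_sumr.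
apply: eq_bigr => m _; rewrite -/(partial j (fun t => b t 0 m) t) partial_b//.
by rewrite !mulrA.
Qed.

Let smooth_A j : smooth V (A j).
Proof.
move=> k; apply: class_CM => //; first exact: smooth_partial.
apply: class_CV => //; first by move=> t /a_gt0 at0; rewrite mulf_neq0// gt_eqF.
by apply: class_CM => //; exact: class_C_cst.
Qed.

Let dA t v k : V t -> is_derive t v (A k) ('D_v (A k) t).
Proof. by move=> Vt; exact: smooth_is_derive (smooth_A k) Vt. Qed.

(** A_j is the derivative of log s. *)
Lemma partial_A_sym t j k : V t -> partial k (A j) t = partial j (A k) t.
Proof.
move=> Vt; have at0 := lt0r_neq0 (a_gt0 Vt).
have H i l : partial l (A i) t =
    partial l (partial i a) t / (2 * a t)
    - partial i a t * partial l a t / (2 * a t ^+ 2).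
  have a2 : 2 * a t != 0 by rewrite mulf_neq0.
  have dp := smooth_is_derive (e l) (smooth_partial i smooth_a) Vt.
  have d2 : is_derive t (e l) (fun t => 2 * a t) _ :=
    is_derive_mul (is_derive_cst (2 : R) t (e l)) (da (e l) Vt).
  have [_ E] := is_derive_mul dp (is_derive_inv (f := fun t => 2 * a t) a2 d2).
  rewrite [LHS]E -!/(partial _ _ _) /=; by field.
by rewrite !H (partialC j k oV smooth_a Vt) [partial k a t * _]mulrC.
Qed.

(** Compatibility of the equations for a single b_m; b_0 exists because N > 1. *)
Lemma partial_A t j k : V t -> j != k ->
  partial k (A j) t = 2 * (1 + Q j t * Q k t) / (Q j t - Q k t) ^+ 2 * (A j t * A k t).
Proof.
move=> Vt jk; pose m := Ordinal n_gt0.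
have second i l : i != l -> partial l (partial i (fun t => b t 0 m)) t =
    partial l (A i) t * (1 + b t 0 m ^+ 2) / (Q i t - b t 0 m)
    + A i t * (2 * b t 0 m * partial l (fun t => b t 0 m) t / (Q i t - b t 0 m)
        - (1 + b t 0 m ^+ 2) * (partial l (Q i) t - partial l (fun t => b t 0 m) t)
          / (Q i t - b t 0 m) ^+ 2).
  move=> il; have [Qb _] := Q_crit i Vt.
  have nz : Q i t - b t 0 m != 0 by rewrite subr_eq0.
  have dn : is_derive t (e l) (fun t => A i t * (1 + b t 0 m ^+ 2)) _ :=
    is_derive_mul (dA (e l) i Vt)
      (is_derive_add (is_derive_cst (1 : R) t (e l)) (is_derive_exp 2 (db (e l) m Vt))).
  have dd : is_derive t (e l) (fun t => Q i t - b t 0 m) _ :=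
    is_derive_sub (dQ (e l) i Vt) (db (e l) m Vt).
  have E := is_derive_mul dn (is_derive_inv (f := fun t => Q i t - b t 0 m) nz dd).
  have N : \forall y \near t, A i y * (1 + b y 0 m ^+ 2) * (Q i y - b y 0 m)^-1 =
      partial i (fun t => b t 0 m) y.
    by apply: near_V Vt _ => y Vy; rewrite partial_b.
  have [_ E'] := near_eq_is_derive N E.
  rewrite [LHS]E' -!/(partial _ _ _) /=; by field.
have := partialC k j oV (smooth_b m) Vt.
rewrite second// second 1?eq_sym// (partial_A_sym j k Vt).
have kj : k != j by rewrite eq_sym.
rewrite !partial_b// !partial_Q//.
apply: gt_algebra; [exact: Q_neq|by case: (Q_crit j Vt)|by case: (Q_crit k Vt)].
Qed.

Lemma semi_hamiltonian_riemann :
  semi_hamiltonian_velocities V (fun i s => velocity q i (Phi s)).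
Proof.
pose M i t := (Num.sqrt (a t))^-1 * Q i t.
have MD : (fun i s => velocity q i (Phi s)) = M by [].
rewrite MD; split=> [t Vt i j|i j k ij jk ik t Vt].
  rewrite /M => /(mulfI _) H; apply: (Q_inj Vt); apply: H.
  by rewrite invr_neq0// gt_eqF// sqrtr_gt0 a_gt0.
have G i' j' y : V y -> i' != j' ->
    partial j' (M i') y / (M j' y - M i' y) =
    A j' y * (1 + 2 * Q i' y ^+ 2 - Q i' y * Q j' y) / (Q j' y - Q i' y) ^+ 2.
  move=> Vy ij'; have ay := a_gt0 Vy.
  have s0 : Num.sqrt (a y) != 0 by rewrite gt_eqF// sqrtr_gt0.
  have [_ E] := is_derive_mul (is_derive_inv (f := fun y => Num.sqrt (a y)) s0
    (is_derive_sqrt (f := a) ay (da (e j') Vy))) (dQ (e j') i' Vy).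
  rewrite [partial _ _ _]E -!/(partial _ _ _) partial_Q// /M.
  have nz : Q j' y - Q i' y != 0 by rewrite subr_eq0 Q_neq// eq_sym.
  rewrite /A; set s := Num.sqrt (a y) in s0 *.
  have -> : a y = s ^+ 2 by rewrite sqr_sqrtr// ltW.
  clearbody s; by field; rewrite ?s0 ?nz.
have dG i' j' k' : i' != j' -> j' != k' -> i' != k' ->
    partial k' (fun t => partial j' (M i') t / (M j' t - M i' t)) t =
    partial k' (A j') t * (1 + 2 * Q i' t ^+ 2 - Q i' t * Q j' t) / (Q j' t - Q i' t) ^+ 2
    + A j' t * ((4 * Q i' t * partial k' (Q i') t - partial k' (Q i') t * Q j' t
                 - Q i' t * partial k' (Q j') t) / (Q j' t - Q i' t) ^+ 2
       - 2 * (1 + 2 * Q i' t ^+ 2 - Q i' t * Q j' t)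
           * (partial k' (Q j') t - partial k' (Q i') t) / (Q j' t - Q i' t) ^+ 3).
  move=> ij' jk' ik'.
  have nz : Q j' t - Q i' t != 0 by rewrite subr_eq0 Q_neq// eq_sym.
  have nz2 : (Q j' t - Q i' t) ^+ 2 != 0 by rewrite expf_neq0.
  have di := dQ (e k') i' Vt; have dj := dQ (e k') j' Vt.
  have d1 : is_derive t (e k')
      (fun t => A j' t * (1 + 2 * Q i' t ^+ 2 - Q i' t * Q j' t)) _ :=
    is_derive_mul (dA (e k') j' Vt) (is_derive_sub (is_derive_add
      (is_derive_cst (1 : R) t (e k')) (is_derive_mul (is_derive_cst (2 : R) t (e k'))
        (is_derive_exp 2 di))) (is_derive_mul di dj)).
  have d2 : is_derive t (e k') (fun t => (Q j' t - Q i' t) ^+ 2) _ :=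
    is_derive_exp 2 (is_derive_sub dj di).
  have E := is_derive_mul d1 (is_derive_inv (f := fun t => (Q j' t - Q i' t) ^+ 2) nz2 d2).
  have N : \forall y \near t, A j' y * (1 + 2 * Q i' y ^+ 2 - Q i' y * Q j' y)
      * ((Q j' y - Q i' y) ^+ 2)^-1 = partial j' (M i') y / (M j' y - M i' y).
    by apply: near_V Vt _ => y Vy; rewrite G.
  have [_ E'] := near_eq_is_derive N E.
  rewrite [LHS]E' -!/(partial _ _ _) /=; by field.
have kj : k != j by rewrite eq_sym.
rewrite !dG// (partial_A_sym k j Vt) !(partial_A Vt jk).
rewrite !partial_Q//.
exact: sh_algebra (Q_neq Vt ij) (Q_neq Vt jk) (Q_neq Vt ik).
Qed.

End SemiHamiltonian.

(** * Conservation laws *)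

Section ExponentialSeries.
Variable R : realType.
Implicit Types g : nat -> R.

Fixpoint expc_seq g k : seq R :=
  if k is k'.+1 then
    rcons (expc_seq g k')
      (k'.+1%:R^-1 * \sum_(i < k'.+1) g i * nth 0 (expc_seq g k') (k' - i))
  else [:: 1].

(** The coefficient of w^k in the exponential of the primitive of the series
    \sum_i g_i w^i, by the recursion (k+1) c_(k+1) = \sum_(i <= k) g_i c_(k-i). *)
Definition expc g k : R := nth 0 (expc_seq g k) k.

Lemma size_expc_seq g k : size (expc_seq g k) = k.+1.
Proof. by elim: k => [//|k IH] /=; rewrite size_rcons IH. Qed.

Lemma nth_expc_seq g k i : (i <= k)%N -> nth 0 (expc_seq g k) i = expc g i.
Proof.
elim: k => [|k IH]; first by rewrite leqn0 => /eqP->.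
rewrite leq_eqVlt => /orP[/eqP->//|]; rewrite ltnS => ik.
by rewrite /= nth_rcons size_expc_seq ltnS ik IH.
Qed.

Lemma expcS g k :
  expc g k.+1 = k.+1%:R^-1 * \sum_(i < k.+1) g i * expc g (k - i).
Proof.
rewrite {1}/expc /= nth_rcons size_expc_seq ltnn eqxx; congr (_ * _).
by apply: eq_bigr => i _; rewrite nth_expc_seq// leq_subr.
Qed.

Lemma expc_rec g k : k%:R * expc g k = \sum_(i < k) g i * expc g (k.-1 - i).
Proof.
case: k => [|k]; first by rewrite mul0r big_ord0.
by rewrite expcS mulVKf// pnatr_eq0.
Qed.

Lemma sum_convol_exchange k (F : nat -> nat -> R) :
  \sum_(i < k) \sum_(l < k.-1 - i) F i l = \sum_(l < k) \sum_(i < k.-1 - l) F i l.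
Proof.
have W (G : nat -> R) i : \sum_(l < k.-1 - i) G l = \sum_(l < k | (l < k.-1 - i)%N) G l.
  by rewrite (big_ord_widen k)// (leq_trans (leq_subr _ _))// leq_pred.
under eq_bigr do rewrite (W (F _)).
under [RHS]eq_bigr do rewrite (W (F^~ _)).
rewrite (exchange_big_dep xpredT)//=; apply: eq_bigr => l _.
by apply: eq_bigl => i; rewrite !ltn_subRL addnC.
Qed.

(** If the primitive of the series g has derivative D then its exponential W has
    derivative D W; the coefficient of w^(i+1) in D is d_i. *)
Lemma is_derive_expc (V : normedModType R) (g : nat -> V -> R) (d : nat -> R) (x v : V) k :
  (forall i, is_derive x v (g i) (i.+1%:R * d i)) ->
  is_derive x v (fun y => expc (g^~ y) k)
    (\sum_(i < k) d i * expc (g^~ x) (k.-1 - i)).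
Proof.
move=> dg; set c := expc (g^~ x).
elim/ltn_ind: k => -[|k] IH.
  by rewrite big_ord0; exact: is_derive_cst.
have h : is_derive x v (fun y => \sum_(i < k.+1) g i y * expc (g^~ y) (k - i))
    (\sum_(i < k.+1) (i.+1%:R * d i * c (k - i)%N
       + g i x * \sum_(l < k - i) d l * c ((k - i).-1 - l)%N)).
  apply: is_derive_bigsum => j; apply: is_derive_mul => //.
  by apply: IH; rewrite ltnS leq_subr.
have -> : (fun y => expc (g^~ y) k.+1) =
    (fun y => k.+1%:R^-1 * \sum_(i < k.+1) g i y * expc (g^~ y) (k - i)).
  by apply/funext => y; rewrite expcS.
have := is_derive_mul (is_derive_cst (k.+1%:R^-1 : R) x v) h.
move=> E; apply: (is_derive_eq E).
rewrite mul0r add0r /=; apply: (canLR (mulKf _)); first by rewrite pnatr_eq0.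
rewrite big_split/=.
under [X in _ + X]eq_bigr do rewrite mulr_sumr.
rewrite (@sum_convol_exchange k.+1 (fun i l => g i x * (d l * c ((k - i).-1 - l)%N))).
rewrite -big_split/= mulr_sumr; apply: eq_bigr => l _.
have -> : \sum_(i < k - l) g i x * (d l * c ((k - i).-1 - l)%N) =
    d l * ((k - l)%:R * c (k - l)%N).
  rewrite expc_rec mulr_sumr; apply: eq_bigr => i _.
  by rewrite mulrCA; congr (_ * (_ * c _)); lia.
have lk : (l <= k)%N by rewrite -ltnS.
rewrite natrB// -[k.+1%:R]natr1 -[(l : nat).+1%:R]natr1.
by move: (c _) (d l) => cl dl; ring.
Qed.

Lemma class_C_expc p j (U : set 'rV[R]_p) (g : nat -> 'rV[R]_p -> R) k : open U ->
  (forall i, class_C j U (g i)) -> class_C j U (fun y => expc (g^~ y) k).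
Proof.
move=> oU gC; elim/ltn_ind: k => -[|k] IH; first exact: class_C_cst.
apply: (@class_C_near _ _ _ _
  (fun y => k.+1%:R^-1 * \sum_(i < k.+1) g i y * expc (g^~ y) (k - i))) => //.
  by move=> y _; rewrite expcS.
apply: class_CM => //; first exact: class_C_cst.
apply: class_C_sum => // i; apply: class_CM => //.
by apply: IH; rewrite ltnS leq_subr.
Qed.

End ExponentialSeries.

Section Densities.
Variables (R : realType) (n : nat).

(** The coefficients of w / (1 + w^2). *)
Definition alt_odd (i : nat) : R := if odd i then (-1) ^+ i./2 else 0.

Definition power_sum (b : 'rV[R]_n) (i : nat) : R := \sum_m b 0 m ^+ i.

(** The number j N - 3 for j = K + 2, twice the exponent of 1 + w^2 in W_j. *)
Definition lax_exponent (K : nat) : R := K.+2%:R * n.+1%:R - 3.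

(** The coefficients of the logarithmic derivative of
    W_j = (1 + w^2)^((j N - 3)/2) \prod_m (1 - b_m w)^(-j), where j = K + 2. *)
Definition dlog_coef (K : nat) (b : 'rV[R]_n) (i : nat) : R :=
  K.+2%:R * power_sum b i.+1 + lax_exponent K * alt_odd i.

(** The coefficient of w^k in W_j, j = K + 2. *)
Definition lax_coef (K k : nat) (b : 'rV[R]_n) : R := expc (dlog_coef K b) k.

Definition density (K : nat) (u : 'rV[R]_n.+1) : R :=
  Num.sqrt (acoord u) ^+ K.+2 * lax_coef K K (bcoord u).

Definition flux (K : nat) (u : 'rV[R]_n.+1) : R :=
  Num.sqrt (acoord u) ^+ K.+1 * lax_coef K K.+1 (bcoord u).

Lemma alt_oddSS i : alt_odd i.+2 = - alt_odd i.
Proof.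
rewrite /alt_odd /= negbK; case: (odd i); last by rewrite oppr0.
by rewrite exprS mulN1r.
Qed.

(** For K > 0 both sides follow from the recursion for the coefficient of index
    K - 1, because j n + (K - 1) = j N - 3 and because w / (1 + w^2) satisfies
    [alt_oddSS]. *)
Lemma lax_coef_shift K (b : 'rV[R]_n) :
  K.+2%:R * \sum_(i < K) power_sum b i * lax_coef K (K.-1 - i) b =
  lax_exponent K * \sum_(i < K.+1) alt_odd i * lax_coef K (K - i) b.
Proof.
case: K => [|K].
  by rewrite !big_ord0 big_ord_recl big_ord0 /alt_odd/= mul0r addr0 !mulr0.
pose c k := lax_coef K.+1 k b.
pose S := \sum_(i < K) power_sum b i.+1 * c (K.-1 - i)%N.
pose T := \sum_(i < K) alt_odd i * c (K.-1 - i)%N.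
have cK : K%:R * c K = K.+3%:R * S + lax_exponent K.+1 * T.
  rewrite /c /lax_coef expc_rec /S /T !mulr_sumr -big_split/=.
  by apply: eq_bigr => i _; rewrite mulrDl !mulrA.
have -> : \sum_(i < K.+1) power_sum b i * lax_coef K.+1 (K.+1.-1 - i) b = n%:R * c K + S.
  rewrite big_ord_recl /= subn0; congr (_ + _).
    rewrite /power_sum; under eq_bigr do rewrite expr0.
    by rewrite sumr_const card_ord.
  by apply: eq_bigr => i _; congr (_ * c _); rewrite /bump; lia.
have -> : \sum_(i < K.+2) alt_odd i * lax_coef K.+1 (K.+1 - i) b = c K - T.
  rewrite !big_ord_recl /= {1}/alt_odd/= mul0r add0r /bump/= {1}/alt_odd/= mul1r.
  rewrite -sumrN; congr (_ + _); first by congr c; lia.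
  apply: eq_bigr => i _; rewrite -mulNr -alt_oddSS; congr (_ * c _); lia.
have w : lax_exponent K.+1 = K.+3%:R * n%:R + K%:R.
  have -> : K.+3%:R = 3 + K%:R :> R by rewrite -natrD.
  by rewrite /lax_exponent -[n.+1%:R]natr1 -[K.+3%:R]/((3 + K)%:R) natrD; ring.
transitivity (K.+3%:R * n%:R * c K + (K%:R * c K - lax_exponent K.+1 * T)).
  by rewrite cK; ring.
by rewrite w; ring.
Qed.

(** The coefficient of s_x in the conservation law.  It expresses that a total
    q-derivative has no residue. *)
Lemma lax_coef_identity K (b : 'rV[R]_n) :
  K.+1%:R * lax_coef K K.+1 b = K.+2%:R * (power_sum b 1 * lax_coef K K b
    + \sum_(i < K) (power_sum b i + power_sum b i.+2) * lax_coef K (K.-1 - i) b).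
Proof.
pose c k := lax_coef K k b.
rewrite -/(c K) {1}/lax_coef expc_rec /=.
have -> : \sum_(i < K.+1) dlog_coef K b i * expc (dlog_coef K b) (K - i) =
    K.+2%:R * \sum_(i < K.+1) power_sum b i.+1 * c (K - i)%N
    + lax_exponent K * \sum_(i < K.+1) alt_odd i * c (K - i)%N.
  rewrite !mulr_sumr -big_split/=; apply: eq_bigr => i _.
  by rewrite /c /lax_coef mulrDl !mulrA.
rewrite -lax_coef_shift -mulrDr big_ord_recl/= subn0 -addrA; congr (_ * (_ + _)).
rewrite -big_split/=; apply: eq_bigr => i _.
rewrite addrC mulrDl; congr (_ + _ * c _); rewrite /bump/=; lia.
Qed.

End Densities.

Section ConservationLaws.
Variables (R : realType) (n : nat).

Lemma open_phase_space : open (@phase_space R n).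
Proof.
apply: open_near => u u0.
exact: (@cvgr_gt R _ (nbhs u) _ (@acoord R n) _ (@acoord_continuous R n u) 0 u0).
Qed.

Lemma smooth_lax_coef K k : smooth (@phase_space R n)
  (fun u => lax_coef K k (bcoord u)).
Proof.
move=> j; have oP := open_phase_space. apply: (class_C_expc (g := fun i u => dlog_coef K (bcoord u) i)) => // i.
apply: class_CD => //; last exact: class_C_cst.
apply: class_CM => //; first exact: class_C_cst.
by apply: class_C_sum => // m; apply: class_CX => //; exact: class_C_bcoord.
Qed.

Lemma smooth_sqrt_lax_coef k K l : smooth (@phase_space R n)
  (fun u => Num.sqrt (acoord u) ^+ k * lax_coef K l (bcoord u)).
Proof.
move=> j; have oP := open_phase_space.
apply: class_CM => //; last exact: smooth_lax_coef.
apply: class_CX => //; apply: class_C_sqrt => //; exact: class_C_acoord.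
Qed.

(** The common derivative of densities and fluxes along a field w. *)
Lemma is_derive_sqrt_lax_coef (V : normedModType R) (w : V -> 'rV[R]_n.+1) (x v : V)
    (da : R) (db : 'I_n -> R) k K l :
  0 < acoord (w x) ->
  is_derive x v (fun y => acoord (w y)) da ->
  (forall m, is_derive x v (fun y => bcoord (w y) 0 m) (db m)) ->
  is_derive x v (fun y => Num.sqrt (acoord (w y)) ^+ k * lax_coef K l (bcoord (w y)))
    (Num.sqrt (acoord (w x)) ^+ k * (k%:R * (da / (2 * acoord (w x)))
       * lax_coef K l (bcoord (w x))
     + K.+2%:R * \sum_(i < l) (\sum_m bcoord (w x) 0 m ^+ i * db m)
       * lax_coef K (l.-1 - i) (bcoord (w x)))).
Proof.
move=> a0 ha hb.
have s0 : Num.sqrt (acoord (w x)) != 0 by rewrite gt_eqF// sqrtr_gt0.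
have hs := is_derive_exp k (is_derive_sqrt (f := fun y => acoord (w y)) a0 ha).
have hg i : is_derive x v (fun y => dlog_coef K (bcoord (w y)) i)
    (i.+1%:R * (K.+2%:R * \sum_m bcoord (w x) 0 m ^+ i * db m)).
  have hp : is_derive x v (fun y => power_sum (bcoord (w y)) i.+1) _ :=
    is_derive_bigsum (fun m => is_derive_exp i.+1 (hb m)).
  have := is_derive_add (is_derive_mul (is_derive_cst (K.+2%:R : R) x v) hp)
    (is_derive_cst (lax_exponent R n K * alt_odd R i) x v).
  move=> E; apply: (is_derive_eq E); rewrite mul0r add0r addr0 /= !mulr_sumr.
  by apply: eq_bigr => m _; ring.
have := is_derive_mul hs (is_derive_expc l hg).
move=> E; apply: (is_derive_eq E).
rewrite mulrDr mulrA; congr (_ + _ * _).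
  rewrite /lax_coef; move: (expc _ l) => r; set s := Num.sqrt _ in s0 *.
  have -> : acoord (w x) = s ^+ 2 by rewrite sqr_sqrtr// ltW.
  case: k {hs E} => [|k]; first by rewrite !mul0r mulr0.
  rewrite -pred_Sn [in RHS]exprS; clearbody s.
  by move: (s ^+ k) => t; field.
by rewrite mulr_sumr; apply: eq_bigr => i _; rewrite -mulrA.
Qed.

(** P i is \sum_m b_m^i (b_m)_x.  In the y derivative of the density, s (b_m)_y is
    replaced by b_m (b_m)_x + (1 + b_m^2) alpha0 with alpha0 = s_x / s.  The terms in P
    agree with those of the flux after a shift of the index, and the terms in
    alpha0 agree by [lax_coef_identity]. *)
Lemma conservation_law_density K :
  conservation_law (@ab_system R n) (@phase_space R n) (@density R n K) (@flux R n K).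
Proof.
split; [exact: smooth_sqrt_lax_coef|exact: smooth_sqrt_lax_coef|].
move=> Omega w oO wC wP wS z Oz.
have dw := smooth_rV_differentiable wC Oz; have a0 : 0 < acoord (w z) := wP z Oz.
have := wS z Oz; rewrite (ab_systemE dw a0).
move=> H; set s := Num.sqrt (acoord (w z)) in H *.
have ha i := is_derive_acoord i dw.
pose db i m := partial i (fun z' => bcoord (w z') 0 m) z.
have hb i m : is_derive z (delta_mx 0 i : 'rV[R]_2) (fun z' => bcoord (w z') 0 m) (db i m).
  exact: is_derive_bcoord.
pose alpha i := partial i (fun z' => acoord (w z')) z / (2 * acoord (w z)).
have [H0 Hm] : s * alpha 1 = \sum_m db 0 m + (\sum_m bcoord (w z) 0 m) * alpha 0 /\
  forall m, s * db 1 m = bcoord (w z) 0 m * db 0 m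
             + (1 + bcoord (w z) 0 m ^+ 2) * alpha 0 := H.
have [_ Ey] := is_derive_sqrt_lax_coef K.+2 K K a0 (ha 1) (hb 1).
have [_ Ex] := is_derive_sqrt_lax_coef K.+1 K K.+1 a0 (ha 0) (hb 0).
rewrite /d_y /d_x [LHS]Ey [RHS]Ex -/s -!/(alpha _) {Ey Ex ha hb H}.
have s0 : s != 0 by rewrite gt_eqF// sqrtr_gt0.
move: H0 Hm; move: (db 0) (db 1) (alpha 1) (alpha 0) => b0 b1 alpha1 alpha0.
move: (bcoord (w z)) s s0 => b s s0 H0 Hm {alpha db}.
pose c k := lax_coef K k b; pose P i := \sum_m b 0 m ^+ i * b0 m.
pose P1 := \sum_(i < K) P i.+1 * c (K.-1 - i)%N.
have Sy : s * (\sum_(i < K) (\sum_m b 0 m ^+ i * b1 m) * c (K.-1 - i)%N) =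
    P1 + alpha0 * \sum_(i < K) (power_sum b i + power_sum b i.+2) * c (K.-1 - i)%N.
  rewrite !mulr_sumr -big_split/=; apply: eq_bigr => i _.
  rewrite !mulrA -mulrDl; congr (_ * _).
  rewrite /P /power_sum -big_split/= !mulr_sumr -big_split/=; apply: eq_bigr => m _.
  by rewrite mulrCA Hm !exprS; ring.
have Sx : \sum_(i < K.+1) (\sum_m b 0 m ^+ i * b0 m) * lax_coef K (K.+1.-1 - i) b =
    P 0%N * c K + P1.
  rewrite big_ord_recl /= subn0; congr (_ + _); apply: eq_bigr => i _.
  by congr (_ * c _); rewrite /bump/=; lia.
have P0 : P 0%N = \sum_m b0 m by apply: eq_bigr => m _; rewrite expr0 mul1r.
have p1 : power_sum b 1 = \sum_m b 0 m by apply: eq_bigr => m _; rewrite expr1.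
transitivity (s ^+ K.+1 * (K.+2%:R * (s * alpha1) * c K + K.+2%:R *
   (s * \sum_(i < K) (\sum_m b 0 m ^+ i * b1 m) * c (K.-1 - i)%N))).
  by rewrite exprS /c; ring.
have rid' : K.+1%:R * alpha0 * lax_coef K K.+1 b = alpha0 * (K.+1%:R * lax_coef K K.+1 b).
  by rewrite mulrCA mulrA.
rewrite rid' lax_coef_identity Sx Sy H0 -P0 -p1 -/(c K).
congr (_ * _); by move: (\sum_(i < K) _) => T; ring.
Qed.

End ConservationLaws.

(** * Polynomials in the moments and independence of the densities *)

Section PolynomialInMoments.
Variables (R : realType) (n L : nat).

Definition moment_point (u : 'rV[R]_n.+1) (i : 'I_L.+1) : R :=
  if unlift ord0 i is Some k then moment k u else Num.sqrt (acoord u).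

(** Polynomials in s and in the first L moments; L is fixed so that sums and
    products stay in one polynomial ring. *)
Definition moment_poly (f : 'rV[R]_n.+1 -> R) : Prop :=
  exists P : mpoly.mpoly L.+1 R, forall u, phase_space u ->
    f u = mpoly.meval (moment_point u) P.

Lemma moment_poly_cst c : moment_poly (fun=> c).
Proof. by exists (mpoly.mpolyC _ c) => u _; rewrite mpoly.mevalC. Qed.

Lemma moment_polyD f g : moment_poly f -> moment_poly g ->
  moment_poly (fun u => f u + g u).
Proof.
move=> [P fP] [Q gQ]; exists (P + Q) => u Pu.
by rewrite mpoly.mevalD fP// gQ.
Qed.

Lemma moment_polyM f g : moment_poly f -> moment_poly g ->
  moment_poly (fun u => f u * g u).
Proof.
move=> [P fP] [Q gQ]; exists (P * Q) => u Pu.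
by rewrite mpoly.mevalM fP// gQ.
Qed.

Lemma moment_poly_sum k (f : 'I_k -> 'rV[R]_n.+1 -> R) :
  (forall i, moment_poly (f i)) -> moment_poly (fun u => \sum_(i < k) f i u).
Proof.
elim: k f => [|k IH] f fP.
  have [P H] := moment_poly_cst 0; exists P => u Pu; by rewrite big_ord0; exact: H.
have [P H] := moment_polyD (IH (fun i => f (widen_ord (leqnSn k) i)) (fun i => fP _))
  (fP ord_max).
by exists P => u Pu; rewrite big_ord_recr; exact: H.
Qed.

Lemma moment_polyX f k : moment_poly f -> moment_poly (fun u => f u ^+ k).
Proof.
move=> fP; elim: k => [|k IH].
  by have [P H] := moment_poly_cst 1; exists P => u Pu; rewrite expr0; exact: H.
by have [P H] := moment_polyM fP IH; exists P => u Pu; rewrite exprS; exact: H.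
Qed.

Lemma moment_poly_sqrt : moment_poly (fun u => Num.sqrt (acoord u)).
Proof.
exists (mpoly.mpolyX R (mpoly.mnm1 ord0)) => u _.
by rewrite mpoly.mevalXU /moment_point unlift_none.
Qed.

Lemma moment_poly_power_sum i : (i < L)%N ->
  moment_poly (fun u => power_sum (bcoord u) i.+1).
Proof.
move=> iL; have [P H] : moment_poly (fun u => i.+1%:R * moment i u).
  apply: moment_polyM; first exact: moment_poly_cst.
  exists (mpoly.mpolyX R (mpoly.mnm1 (lift ord0 (Ordinal iL)))) => u _.
  by rewrite mpoly.mevalXU /moment_point liftK.
by exists P => u Pu; rewrite -H// /moment mulVKf// pnatr_eq0.
Qed.

Lemma moment_poly_lax_coef K k : (k <= L)%N ->
  moment_poly (fun u => lax_coef K k (bcoord u)).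
Proof.
elim/ltn_ind: k => -[|k] IH kL; first exact: moment_poly_cst 1.
have [P H] : moment_poly (fun u => k.+1%:R^-1 * \sum_(i < k.+1)
    dlog_coef K (bcoord u) i * lax_coef K (k - i) (bcoord u)).
  apply: moment_polyM; first exact: moment_poly_cst.
  apply: moment_poly_sum => i; apply: moment_polyM.
    apply: moment_polyD; last exact: moment_poly_cst.
    apply: moment_polyM; first exact: moment_poly_cst.
    by apply: moment_poly_power_sum; apply: leq_trans kL.
  have ki : (k - i < k.+1)%N by rewrite ltnS leq_subr.
  by apply: IH => //; exact: leq_trans (ltnW ki) kL.
by exists P => u Pu; rewrite -H// /lax_coef expcS.
Qed.

Lemma moment_poly_sqrt_lax_coef p K k : (k <= L)%N ->
  moment_poly (fun u => Num.sqrt (acoord u) ^+ p * lax_coef K k (bcoord u)).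
Proof.
move=> kL; apply: moment_polyM; last exact: moment_poly_lax_coef.
exact/moment_polyX/moment_poly_sqrt.
Qed.

End PolynomialInMoments.

Lemma polynomial_density (R : realType) n K : polynomial_in_moments (@density R n K).
Proof. by exists K; exact: moment_poly_sqrt_lax_coef. Qed.

Lemma polynomial_flux (R : realType) n K : polynomial_in_moments (@flux R n K).
Proof. by exists K.+1; exact: moment_poly_sqrt_lax_coef. Qed.

Section Independence.
Variable R : realType.

Lemma poly_eq0_near (p : {poly R}) (x : R) : (\forall y \near x, p.[y] = 0) -> p = 0.
Proof.
move=> /nbhs_ballP[/= e e0 He]; apply/eqP/negPn/negP => p0.
pose f (k : nat) := x + e / k.+2%:R.
have fi : injective f.
  move=> k l /addrI /(mulfI (lt0r_neq0 e0)) /invr_inj /eqP.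
  by rewrite eqr_nat => /eqP[].
have := max_poly_roots p0 (rs := [seq f k | k <- iota 0 (size p)]).
rewrite map_inj_uniq// iota_uniq size_map size_iota ltnn => H.
suff : false by [].
apply: H => //; apply/allP => _ /mapP[k _ ->]; rewrite rootE He//.
rewrite -ball_normE/= /f opprD addrA subrr sub0r normrN ger0_norm ?divr_ge0 ?ltW//.
by rewrite ltr_pdivrMr// ltr_pMr// ltr1n.
Qed.

Lemma coefM_top (p q : {poly R}) k l : (size p <= k.+1)%N -> (size q <= l.+1)%N ->
  (p * q)`_(k + l) = p`_k * q`_l.
Proof.
move=> pk ql; have kl : (k < (k + l).+1)%N by rewrite ltnS leq_addr.
rewrite coefM (bigD1 (Ordinal kl))//= addKn big1 ?addr0// => -[i il] /= ik.
have {ik} : i != k by [].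
rewrite neq_ltn => /orP[ik|ki].
  rewrite [X in _ * X]nth_default ?mulr0// (leq_trans ql)//; lia.
by rewrite nth_default ?mul0r// (leq_trans pk).
Qed.

(** Only the term with the leading coefficients of g_i and of the previous
    coefficient contributes to degree k, and all these products are positive. *)
Lemma expc_poly (g : R -> nat -> R) (G : nat -> {poly R}) k :
  (forall i, [/\ forall t, g t i = (G i).[t], (size (G i) <= i.+2)%N & 0 < (G i)`_i.+1]) ->
  exists P : {poly R},
    [/\ forall t, expc (g t) k = P.[t], (size P <= k.+1)%N & 0 < P`_k].
Proof.
move=> GP; elim/ltn_ind: k => -[|k] IH.
  exists 1; rewrite size_poly1 coef1 ltr01; split => // t; by rewrite hornerC.
have /choice[P HP] : forall i : 'I_k.+1, exists P : {poly R},
    [/\ forall t, expc (g t) (k - i) = P.[t], (size P <= (k - i).+1)%N & 0 < P`_(k - i)].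
  by move=> i; apply: IH; rewrite ltnS leq_subr.
exists (k.+1%:R^-1 *: \sum_(i < k.+1) G i * P i); split.
- move=> t; rewrite expcS hornerZ horner_sum; congr (_ * _); apply: eq_bigr => i _.
  by rewrite hornerM; have [-> _ _] := GP i; have [-> _ _] := HP i.
- rewrite (leq_trans (size_scale_leq _ _))// (leq_trans (size_sum _ _ _))//.
  apply/bigmax_leqP => i _; rewrite (leq_trans (size_polyMleq _ _))//.
  have [_ s1 _] := GP i; have [_ s2 _] := HP i; have := ltn_ord i; lia.
- rewrite coefZ mulr_gt0 ?invr_gt0// coef_sum.
  have term (i : 'I_k.+1) : 0 < (G i * P i)`_k.+1.
    have [_ s1 c1] := GP i; have [_ s2 c2] := HP i.
    have ik : (i.+1 + (k - i) = k.+1)%N by have := ltn_ord i; lia.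
    by have := coefM_top s1 s2; rewrite ik => ->; rewrite mulr_gt0.
  by rewrite big_ord_recl ltr_pwDl// sumr_ge0// => i _; exact: ltW.
Qed.

End Independence.

Section DensitiesIndependent.
Variables (R : realType) (n : nat).
Hypothesis n_gt0 : (0 < n)%N.

Lemma near_line p (U : set 'rV[R]_p) (u v : 'rV[R]_p) (h : R -> R) (x : R) :
  open U -> U (h x *: v + u) -> {for x, continuous h} ->
  \forall y \near x, U (h y *: v + u).
Proof.
move=> oU Uu hc.
have c : {for x, continuous (fun y => h y *: v + u)}.
  apply: continuous_rV => i.
  have -> : (fun y => (h y *: v + u) 0 i) = (fun y => h y * v 0 i + u 0 i).
    by apply/funext => y; rewrite !mxE.
  apply: continuousD; last exact: cst_continuous.
  apply: continuousM => //; exact: cst_continuous.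
exact: (c _ (open_nbhs_nbhs (conj oU Uu))).
Qed.

(** As a function of b_0 alone, the coefficient of w^k is a polynomial of degree k, so it
    does not vanish identically near any point. *)
Lemma lax_coef_neq0 K k (U : set 'rV[R]_n.+1) : open U -> U !=set0 ->
  exists u, U u /\ lax_coef K k (bcoord u) != 0.
Proof.
move=> oU [u Uu]; pose m0 := Ordinal n_gt0.
pose v : 'rV[R]_n.+1 := delta_mx 0 (lift ord0 m0).
have bE t m : bcoord (t *: v + u) 0 m = bcoord u 0 m + t *+ (m == m0).
  rewrite !mxE eqxx/= (inj_eq (@lift_inj _ ord0)) mulr_natr addrC.
  by [].
pose B m : {poly R} := (bcoord u 0 m)%:P + 'X *+ (m == m0).
have BE m t : (B m).[t] = bcoord (t *: v + u) 0 m.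
  by rewrite bE /B hornerD hornerC hornerMn hornerX.
pose G i : {poly R} := K.+2%:R *: \sum_m B m ^+ i.+1 + (lax_exponent R n K * alt_odd R i)%:P.
have sB m : (size (B m) <= 2)%N.
  rewrite (leq_trans (size_polyD _ _))// geq_max (leq_trans (size_polyC_leq1 _))//.
  by case: (m == m0); rewrite ?mulr1n ?mulr0n ?size_polyX ?size_poly0.
have sBX m i : (size (B m ^+ i) <= i.+1)%N.
  elim: i => [|i IH]; first by rewrite expr0 size_poly1.
  rewrite exprS (leq_trans (size_polyMleq _ _))//.
  by have := sB m; lia.
have cBX m i : (B m ^+ i)`_i = (m == m0)%:R ^+ i.
  elim: i => [|i IH]; first by rewrite !expr0 coef1.
  rewrite !exprS -[in LHS](add1n i) coefM_top// IH; congr (_ * _).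
  by rewrite /B coefD coefC coefMn coefX add0r.
have [|P [PE _ Pk]] := @expc_poly R (fun t => dlog_coef K (bcoord (t *: v + u))) G k.
  move=> i; split.
  - move=> t; rewrite /G hornerD hornerZ hornerC horner_sum /dlog_coef; congr (_ * _ + _).
    by apply: eq_bigr => m _; rewrite horner_exp BE.
  - rewrite (leq_trans (size_polyD _ _))// geq_max (leq_trans (size_polyC_leq1 _))//.
    rewrite andbT (leq_trans (size_scale_leq _ _))// (leq_trans (size_sum _ _ _))//.
    by apply/bigmax_leqP => m _.
  - rewrite /G coefD coefZ coefC addr0 coef_sum mulr_gt0// (bigD1 m0)//= cBX eqxx expr1n.
    by rewrite ltr_pwDl// sumr_ge0// => m _; rewrite cBX exprn_ge0.
have P0 : P != 0 by apply: contraTneq Pk => ->; rewrite coef0 ltxx.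
apply: contrapT => H; move/eqP: P0; apply; apply: (@poly_eq0_near R P 0).
have N : \forall t \near (0 : R), U (t *: v + u).
  by apply: (near_line (h := id)) => //; rewrite scale0r add0r.
apply: filterS N => t Ut; rewrite -PE; apply/eqP/negPn/negP => nz.
by apply: H; exists (t *: v + u).
Qed.

(** For fixed b the relation is a polynomial in s which vanishes on an interval, and
    the j-th density is the only one of degree j + 2 in s.  Choose b where its
    coefficient is nonzero. *)
Lemma densities_independent_mod_cst (U : set 'rV[R]_n.+1) m (c : 'I_m -> R) (c0 : R) :
  open U -> U !=set0 -> U `<=` @phase_space R n ->
  (forall u, U u -> \sum_(j < m) c j * density j u = c0) -> forall j, c j = 0.
Proof.
move=> oU U0 UP H j; have [u [Uu rn]] := lax_coef_neq0 j j oU U0.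
have a0 : 0 < acoord u := UP _ Uu.
pose s0 := Num.sqrt (acoord u); have s0gt : 0 < s0 by rewrite sqrtr_gt0.
pose v : 'rV[R]_n.+1 := delta_mx 0 ord0.
pose w (x : R) := (x ^+ 2 - acoord u) *: v + u.
have wa x : acoord (w x) = x ^+ 2.
  by rewrite /acoord !mxE !eqxx mulr1 subrK.
have wb x : bcoord (w x) = bcoord u.
  apply/rowP => l; rewrite !mxE /= mulr0 add0r.
  by [].
pose P : {poly R} := \sum_(i < m) (c i * lax_coef i i (bcoord u)) *: 'X^(i.+2) - c0%:P.
have P0 : P = 0.
  apply: (@poly_eq0_near R P s0).
  have N : \forall x \near s0, U (w x).
    apply: (near_line (h := fun x => x ^+ 2 - acoord u)) => //.
      by rewrite sqr_sqrtr ?ltW// subrr scale0r add0r.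
    have -> : (fun x => x ^+ 2 - acoord u) = horner ('X^2 - (acoord u)%:P).
      by apply/funext => x; rewrite !hornerE.
    exact: continuous_horner.
  have N' : \forall x \near s0, 0 < x by exact: lt_nbhsr.
  apply: filterS2 N N' => x Ux x0.
  have := H _ Ux; rewrite /P hornerD hornerN hornerC horner_sum => <-.
  apply/eqP; rewrite subr_eq0; apply/eqP; apply: eq_bigr => i _.
  rewrite hornerZ hornerXn /density wa wb sqrtr_sqr gtr0_norm//.
  by rewrite -mulrA [_ * lax_coef _ _ _]mulrC.
have := congr1 (fun p : {poly R} => p`_j.+2) P0; rewrite /P coefB coefC coef0 subr0.
rewrite coef_sum (bigD1 j)//= coefZ coefXn eqxx mulr1 big1 ?addr0.
  by move=> /eqP; rewrite mulf_eq0 (negPf rn) orbF => /eqP.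
move=> i; rewrite -val_eqE/= => ij.
by rewrite coefZ coefXn !eqSS eq_sym (negPf ij) mulr0.
Qed.

(** A constant density would be a linear relation modulo constants. *)
Lemma density_nonconstant (U : set 'rV[R]_n.+1) K :
  open U -> U !=set0 -> U `<=` @phase_space R n -> nonconstant_on U (@density R n K).
Proof.
move=> oU U0 UP [c0 H].
have := @densities_independent_mod_cst U K.+1 (fun i => (i == ord_max)%:R) c0 oU U0 UP.
case/(_ _ ord_max)/eqP/negP; last by rewrite eqxx oner_eq0.
move=> u Uu; rewrite (bigD1 ord_max)//= eqxx mul1r big1 ?addr0 ?H// => i /negPf->.
by rewrite mul0r.
Qed.

End DensitiesIndependent.

Theorem mainTheorem3 (R : realType) (n : nat) (hN : (2 <= n.+1)%N) :
  semi_hamiltonian (@ab_system R n) (@regular_domain R n) /\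
  (forall D : set 'rV[R]_n.+1, open D -> D `<=` @regular_domain R n ->
     diagonalizable_system (@ab_system R n) D /\
     forall q : 'I_n.+1 -> 'rV[R]_n -> R, root_branches D q ->
       riemann_invariants (@ab_system R n) D (riemann_r q) (velocity q)) /\
  (exists rho sigma : nat -> 'rV[R]_n.+1 -> R,
     (forall j, [/\ conservation_law (@ab_system R n) (@phase_space R n)
                      (rho j) (sigma j),
                    polynomial_in_moments (rho j) &
                    polynomial_in_moments (sigma j)]) /\
     (forall U : set 'rV[R]_n.+1, open U -> U !=set0 -> U `<=` @phase_space R n ->
        linearly_independent_on U rho /\
        forall j, nonconstant_on U (rho j))).
Proof.
have n_gt0 : (0 < n)%N by [].
split; [|split].
- move=> u /(regular_root_branches n_gt0)[D [q [oD Du DR qD]]].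
  have [U [V [Phi [Uu UD qC C]]]] := riemann_coordinates n_gt0 oD DR qD Du.
  exists U, V, (fun u => \row_i riemann_r q i u), Phi, (fun i s => velocity q i (Phi s)).
  split=> //; first by move=> x /UD/DR.
    exact: diagonal_riemann DR qD UD qC C.
  exact (semi_hamiltonian_riemann n_gt0 DR qD UD qC C).
- move=> D oD DR; split=> [u Du|q qD u Du].
    have [E [q [oE Eu ER qE]]] := regular_root_branches n_gt0 (DR u Du).
    have oDE : open (D `&` E) by exact: openI.
    have DER : D `&` E `<=` @regular_domain R n by move=> x [/DR].
    have qDE : root_branches (D `&` E) q by move=> x [_ /qE].
    have [U [V [Phi [Uu UDE qC C]]]] := riemann_coordinates n_gt0 oDE DER qDE (conj Du Eu).
    exists U, V, (fun u => \row_i riemann_r q i u), Phi, (fun i s => velocity q i (Phi s)).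
    split=> //; first by move=> x /UDE[].
    exact: diagonal_riemann DER qDE UDE qC C.
  have [U [V [Phi [Uu UD qC C]]]] := riemann_coordinates n_gt0 oD DR qD Du.
  by exists U, V, Phi; split=> //; exact: diagonal_riemann DR qD UD qC C.
- exists (@density R n), (@flux R n); split=> [j|U oU U0 UP].
    split; [exact: conservation_law_density|exact: polynomial_density|].
    exact: polynomial_flux.
  split=> [m c H|j]; last exact: density_nonconstant.
  exact: densities_independent_mod_cst oU U0 UP H.
Qed.
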